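(* Let $m$ be a positive integer, $\varepsilon>0$ a real number, and $f$ a positive integer-valued function on $V(G)$ with $f(v)\ge (2m-1)(2m/\varepsilon+1)$ for all $v$. Let $G$ be a graph that is $t$-iso-tough for $t(v)=f(v)(f(v)+1)$. If for all $S\subseteq V(G)$ $$\omega(G\setminus S)\le \frac{1}{2m+\varepsilon}|S|+1,$$ then $G$ has an $m$-tree-connected $(f,f+1)$-factor.
   Context: Graphs are finite, have no loops, but may have multiple edges; degrees count multiplicities. For $S\subseteq V(G)$, $G\setminus S$ is the graph obtained by deleting $S$, $\omega(\cdot)$ is the number of connected components, and $I(G\setminus S)$ is the set of isolated vertices of $G\setminus S$. For a real function $t$ on $V(G)$, $G$ is $t$-iso-tough if $\sum_{v\in I(G\setminus S)}t(v)\le |S|$ for all $S\subseteq V(G)$. A graph is $m$-tree-connected if it contains $m$ edge-disjoint spanning trees. An $(f,f+1)$-factor is a spanning subgraph $F$ with $f(v)\le d_F(v)\le f(v)+1$ for all $v$. *)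

(* Defs.v *)
From HB Require Import structures.
From mathcomp Require Import all_boot all_order all_algebra.
Set Implicit Arguments. Unset Strict Implicit. Unset Printing Implicit Defensive.
Import Order.TTheory GRing.Theory Num.Theory.

(* A finite loopless multigraph G is given by a finite vertex type T, a finite
   edge type E and an endpoint map [ends : E -> T * T] with
   (ends e).1 != (ends e).2.  Parallel edges are distinct elements of E.
   A spanning subgraph is a set of edges F : {set E}. *)

Section Graphs.
Variables (T E : finType) (ends : E -> T * T).

Definition joins (e : E) (x y : T) : bool :=
  (ends e == (x, y)) || (ends e == (y, x)).

Definition incident (v : T) (e : E) : bool :=
  ((ends e).1 == v) || ((ends e).2 == v).

(* degree of v in the spanning subgraph with edge set F (multiplicities
   counted; no loops so each incident edge contributes 1) *)
Definition deg (F : {set E}) (v : T) : nat := #|[set e in F | incident v e]|.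

Definition adjE (A : {set E}) : rel T :=
  fun x y => [exists e in A, joins e x y].

Definition connectedE (A : {set E}) : bool :=
  [forall x, forall y, connect (adjE A) x y].

Definition acyclicE (A : {set E}) : bool :=
  [forall e in A, ~~ connect (adjE (A :\ e)) (ends e).1 (ends e).2].

Definition spanning_tree (A : {set E}) : bool := connectedE A && acyclicE A.

Definition tree_connected (m : nat) (F : {set E}) : Prop :=
  exists Ts : 'I_m -> {set E},
    (forall i, Ts i \subset F) /\ (forall i, spanning_tree (Ts i)) /\
    (forall i j, i != j -> [disjoint Ts i & Ts j]).

Definition adjDel (S : {set T}) : rel T :=
  fun x y => (x \notin S) && (y \notin S) && [exists e, joins e x y].

Definition ncomp (S : {set T}) : nat :=
  #|[set [set y | connect (adjDel S) x y] | x in ~: S]|.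

Definition isolated (S : {set T}) : {set T} :=
  [set v | (v \notin S) && [forall y, ~~ adjDel S v y]].

Definition iso_tough (R : realFieldType) (t : T -> R) : Prop :=
  forall S : {set T}, (\sum_(v in isolated S) t v <= (#|S|%:R : R))%R.

Definition ff1_factor (f : T -> nat) (F : {set E}) : Prop :=
  forall v, f v <= deg F v <= (f v).+1.

End Graphs.

(* Main.v *)
Require Import Defs.
From HB Require Import structures.
From mathcomp Require Import all_boot all_order all_algebra.
From mathcomp Require Import zify lra.
Import Order.TTheory GRing.Theory Num.Theory.

(* Toughness and isolated toughness give Tutte's f-factor condition (deduced here from the
   Tutte-Berge formula by Tutte's gadget), up to parity: there is a spanning subgraph F with
   degrees f, except for at most one vertex of degree f + 1. It is enough to enlarge F by a matching
   avoiding that vertex.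

   Call a set of edges sparse when every nonempty set U of vertices spans at most m (|U| - 1) of
   them. A sparse set of m (|V| - 1) edges has an orientation with indegree m at every vertex but a
   root, hence splits into m spanning trees by Edmonds' branching theorem. Let X be sparse with
   X \ F a matching, |X| maximal, and then the number of edges of F in X maximal. If
   |X| < m (|V| - 1), exchanges yield a part M of the matching such that every edge outside F that
   avoids the vertices covered by M and the exceptional vertex lies inside one of the maximal tight
   sets of X \ M. These are q disjoint classes joined by fewer than m (q - 1) edges of X, so that
   deleting all ends of these edges costs at most 2m (q - 1) - 2 vertices. A class disappears only
   if it absorbs about min f >= (2m - 1)(2m / eps + 1) of the ends; most classes survive, and leave
   more than |S| / (2m + eps) + 1 components. *)

Set Implicit Arguments. Unset Strict Implicit. Unset Printing Implicit Defensive.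

(** * Maximum matchings *)

(** An edge outside [F] that joins two classes may still be unusable because the matching already
    covers one of its ends. Passing from [X \ F] to [M] overcomes this: a vertex not covered by [M]
    can be freed by changing [X] inside its class only. The edges of [M] themselves join different
    classes, so deleting the ends of the joining edges also deletes every covered vertex.

    The threshold on [f] balances the final count. Let r = min f, and let c be the number of joining
    edges, so 2c < 2m (q - 1). A surviving class that meets joining edges uses up at least one of
    their 2c ends, which leaves about (2m - 1)(q - 1) ends for destroying classes, at a price of r
    each. Enough classes survive once r eps >= (2m - 1)(2m + eps), which is the hypothesis. The
    count has no slack of one end per class, whence two precautions: [F] is taken without parallel
    edges, so that a small class holds few edges of [F] at each vertex, and some destroyed classes
    are revived by putting back one vertex. *)

Section Matchings.
Variables (V : finType) (g : rel V).
Hypothesis gsym : symmetric g.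
Implicit Types (W X Y : {set V}) (mu nu : {ffun V -> V}).

(* A matching is encoded as an involution whose fixed points are the uncovered vertices. *)
Definition matching W mu : bool :=
  [forall x, (mu (mu x) == x) && ((mu x != x) ==> (x \in W) && g x (mu x))].

Definition missed W mu : {set V} := [set x in W | mu x == x].

Definition max_matching W mu : bool :=
  matching W mu && [forall nu, matching W nu ==> (#|missed W mu| <= #|missed W nu|)].

Definition restr W : rel V := fun x y => [&& x \in W, y \in W & g x y].

Lemma matchingP W mu :
  reflect ((forall x, mu (mu x) = x) /\
           (forall x, mu x != x -> x \in W /\ g x (mu x)))
          (matching W mu).
Proof.
apply: (iffP forallP) => [H|[H1 H2] x].
  split=> x; have /andP[/eqP h1 /implyP h2] := H x => //.
  by move/h2/andP.
by rewrite H1 eqxx /=; apply/implyP => /H2[-> ->].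
Qed.

Lemma matchingK W mu x : matching W mu -> mu (mu x) = x.
Proof. by case/matchingP. Qed.

Lemma matching_edge W mu x :
  matching W mu -> mu x != x -> [/\ x \in W, mu x \in W & g x (mu x)].
Proof.
case/matchingP=> H1 H2 hx; have [h1 h2] := H2 _ hx; split=> //.
by have [] := H2 (mu x) _; rewrite ?H1 // eq_sym.
Qed.

Lemma matching_sub W W' mu : W \subset W' -> matching W mu -> matching W' mu.
Proof.
move=> /subsetP sW /matchingP[H1 H2]; apply/matchingP; split=> // x /H2[h1 h2].
by split=> //; apply: sW.
Qed.

Lemma max_matchingP W mu :
  reflect (matching W mu /\
           forall nu, matching W nu -> #|missed W mu| <= #|missed W nu|)
          (max_matching W mu).
Proof.
apply: (iffP andP) => -[H1 H2]; split=> //.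
  by move=> nu; apply/implyP; move/forallP: H2.
by apply/forallP=> nu; apply/implyP; apply: H2.
Qed.

Lemma max_matching_exists W : exists mu, max_matching W mu.
Proof.
have H : matching W [ffun x => x].
  by apply/matchingP; split=> x; rewrite !ffunE ?eqxx.
case: (@arg_minnP _ [ffun x => x] (matching W) (fun mu => #|missed W mu|) H) => mu h1 h2.
by exists mu; apply/max_matchingP.
Qed.

Lemma involution_even (h : V -> V) (C : {set V}) :
  (forall x, h (h x) = x) -> (forall x, x \in C -> h x \in C) ->
  (forall x, x \in C -> h x != x) -> ~~ odd #|C|.
Proof.
move=> hK; have [n le_n] := ubnP #|C|; elim: n C le_n => // n IH C le_n hC hF.
have [->|[x xC]] := set_0Vmem C; first by rewrite cards0.
have hxC := hC _ xC; have nx := hF _ xC.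
have e1 : #|C| = (#|C :\ x :\ h x|).+2.
  by rewrite (cardsD1 x) xC (cardsD1 (h x) (C :\ x)) !inE nx hxC.
rewrite e1 /= negbK; apply: IH.
- by move: le_n; rewrite e1 !ltnS => /ltnW.
- move=> y; rewrite !inE => /and3P[y1 y2 yC]; rewrite hC // andbT.
  by rewrite (can_eq hK) y2 /=; apply: contra y1 => /eqP<-; rewrite hK.
- by move=> y; rewrite !inE => /and3P[_ _ /hF].
Qed.

Lemma odd_missed W mu : matching W mu -> odd #|missed W mu| = odd #|W|.
Proof.
move=> mW; have -> : #|W| = #|missed W mu| + #|W :\: missed W mu|.
  rewrite -(cardsID (missed W mu) W); congr (#|pred_of_set _| + _).
  by apply/setP=> x; rewrite !inE; case: (x \in W).
have /negbTE e : ~~ odd #|W :\: missed W mu|; last by rewrite oddD e addbF.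
apply: (@involution_even mu) => [x|x|x].
- exact: matchingK mW.
- rewrite !inE => /andP[h xW]; rewrite xW /= in h.
  by have [_ -> _] := matching_edge mW h; rewrite (matchingK x mW) eq_sym h.
- by rewrite !inE => /andP[h xW]; rewrite xW in h.
Qed.

(** The exchange step: an uncovered [x] takes [y] away from its partner, which becomes uncovered. If
    [y] was uncovered as well, the matching grows. *)
Definition reroute mu x y : {ffun V -> V} :=
  [ffun a => if a == x then y else if a == y then x
             else if a == mu y then a else mu a].

Lemma reroute_matching W mu x y :
  matching W mu -> mu x = x -> x != y -> x \in W -> y \in W -> g x y ->
  matching W (reroute mu x y).
Proof.
move=> mW mx nxy xW yW gxy; have K := fun a => matchingK a mW.
apply/matchingP; split=> a; rewrite /reroute !ffunE.
- case: (eqVneq a x) => [->|nax]; first by rewrite eq_sym (negbTE nxy) eqxx.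
  case: (eqVneq a y) => [->|nay]; first by rewrite eqxx.
  case: (eqVneq a (mu y)) => [E|nam].
    by rewrite E in nax nay *; rewrite (negbTE nax) (negbTE nay) eqxx.
  case: (eqVneq (mu a) x) => [E|_]; first by rewrite -(K a) E mx ?eqxx in nax.
  case: (eqVneq (mu a) y) => [E|_]; first by rewrite -E K eqxx in nam.
  case: (eqVneq (mu a) (mu y)) => [E|_]; last exact: K.
  by rewrite -(K a) E K eqxx in nay.
- case: (eqVneq a x) => [->|nax]; first by [].
  case: (eqVneq a y) => [->|nay]; first by rewrite gsym.
  case: (eqVneq a (mu y)) => [->|nam]; first by rewrite eqxx.
  by move=> /(matching_edge mW)[].
Qed.

Lemma missed_reroute W mu x y :
  matching W mu -> mu x = x -> x != y -> x \in W -> y \in W ->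
  missed W (reroute mu x y) =
    if mu y == y then missed W mu :\ x :\ y else mu y |: (missed W mu :\ x).
Proof.
move=> mW mx nxy xW yW; have K := fun a => matchingK a mW.
apply/setP=> a; rewrite (fun_if (fun s : {set V} => a \in s)) !inE /reroute ffunE.
case: (eqVneq a x) => [->|nax] /=.
  rewrite xW eq_sym (negbTE nxy) /= orbF.
  by case: ifP => // _; apply/esym/eqP => E; move: (K y) nxy; rewrite -E mx => ->; rewrite eqxx.
case: (eqVneq a y) => [->|nay] /=.
  rewrite yW (negbTE nxy) /=; case: ifP => // h.
  by rewrite eq_sym h.
case: (eqVneq a (mu y)) => [E|nam] /=; last by case: ifP.
case: ifP => [/eqP E2|/eqP E2]; first by rewrite E E2 eqxx in nay.
rewrite eqxx andbT E; have [] := matching_edge mW (introN eqP E2) => //.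
Qed.

Lemma max_matching_nonadj W mu x y :
  max_matching W mu -> x \in missed W mu -> y \in missed W mu -> x != y -> ~~ g x y.
Proof.
case/max_matchingP=> mW mM; rewrite !inE => /andP[xW /eqP mx] /andP[yW /eqP my] nxy.
apply/negP=> gxy; have := mM _ (reroute_matching mW mx nxy xW yW gxy).
rewrite (missed_reroute mW) // my eqxx.
rewrite (cardsD1 x (missed W mu)) inE xW mx eqxx (cardsD1 y (missed W mu :\ x)).
by rewrite !inE yW my eq_sym nxy eqxx; lia.
Qed.

Lemma card_missed_reroute W mu x y :
  matching W mu -> mu x = x -> x != y -> x \in W -> y \in W -> mu y != y ->
  #|missed W (reroute mu x y)| = #|missed W mu|.
Proof.
move=> mW mx nxy xW yW ny; rewrite (missed_reroute mW) // (negbTE ny).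
have e1 : x \in missed W mu by rewrite inE xW mx eqxx.
have /negbTE e2 : mu y \notin missed W mu :\ x.
  by rewrite !inE (matchingK y mW) (eq_sym y) (negbTE ny) !andbF.
by rewrite cardsU1 (cardsD1 x (missed W mu)) e1 e2.
Qed.

Definition jointly_missed W u v :=
  [exists mu, max_matching W mu && (u \in missed W mu) && (v \in missed W mu)].

(* Gallai: among the pairs of maximum matchings, one missing [u], [v] and the other missing [t],
   take one with as many common edges as possible. *)
Lemma jointly_missed_trans W u t v :
  u != v -> (exists2 nu, max_matching W nu & t \in missed W nu) ->
  ~~ jointly_missed W u t -> ~~ jointly_missed W t v -> ~~ jointly_missed W u v.
Proof.
move=> nuv [nu0 nu0m nu0t] nut ntv; apply/negP.
case/existsP=> mu /andP[/andP[muM muu] muv].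
pose agree (nu : {ffun V -> V}) := [set a | (mu a == nu a) && (mu a != a)].
have [nu] : exists nu, [/\ max_matching W nu, t \in missed W nu &
   forall nu', max_matching W nu' -> t \in missed W nu' -> #|agree nu'| <= #|agree nu|].
  pose P nu := max_matching W nu && (t \in missed W nu).
  have P0 : P nu0 by rewrite /P nu0m.
  case: (@arg_maxnP _ nu0 P (fun nu => #|agree nu|) P0) => nu /andP[h1 h2] h3.
  by exists nu; split=> // nu' h4 h5; apply: h3; rewrite /P h4.
case=> nuM nut' best.
have tmu : t \notin missed W mu.
  by apply: contra nut => h; apply/existsP; exists mu; rewrite muM muu.
have unu : u \notin missed W nu.
  by apply: contra nut => h; apply/existsP; exists nu; rewrite nuM h.
have vnu : v \notin missed W nu.
  by apply: contra ntv => h; apply/existsP; exists nu; rewrite nuM nut'.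
have /max_matchingP[muW muX] := muM; have /max_matchingP[nuW nuX] := nuM.
have ecard : #|missed W mu| = #|missed W nu| by apply/eqP; rewrite eqn_leq muX ?nuX.
(* Both matchings miss equally many vertices. As [u] and [v] are missed by [mu] only, at least two
   vertices are missed by [nu] only, hence one besides [t]. *)
have [x] : exists x, x \in (missed W nu :\: missed W mu) :\ t.
  apply/set0Pn; rewrite -card_gt0.
  have h2 : 1 < #|missed W mu :\: missed W nu|.
    by apply/card_gt1P; exists u, v; split=> //; rewrite in_setD ?unu ?vnu.
  have := cardsID (missed W mu) (missed W nu); have := cardsID (missed W nu) (missed W mu).
  rewrite setIC ecard => <- /addnI E; rewrite -E (cardsD1 t) in h2.
  by move: h2; rewrite [t \in _]inE tmu nut'.
rewrite in_setD1 in_setD => /and3P[xt xmu xnu].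
have [xW /eqP nux] : x \in W /\ nu x == x by move: xnu; rewrite inE => /andP.
have mux : mu x != x by move: xmu; rewrite inE xW.
have [_ yW gxy] := matching_edge muW mux; set y := mu x in yW gxy mux.
have nxy : x != y by rewrite eq_sym.
have nuy : nu y != y.
  apply/negP=> /eqP h; have := @max_matching_nonadj W nu x y nuM.
  by rewrite !inE xW yW nux h !eqxx gxy => /(_ isT isT nxy).
(* The edge [x y] of [mu] is gained. The edge lost, between [y] and [nu y], is not in [mu], so the
   agreement grows. *)
pose nu' := reroute nu x y.
have nu'W : matching W nu' by apply: reroute_matching.
have nu'M : max_matching W nu'.
  apply/max_matchingP; split=> // k /nuX.
  by rewrite (card_missed_reroute nuW).
have tnu' : t \in missed W nu'.
  rewrite (missed_reroute nuW) // (negbTE nuy) in_setU1 in_setD1 nut'.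
  by rewrite (eq_sym t x) xt orbT.
have := best _ nu'M tnu'; rewrite leqNgt => /negP; apply.
apply: proper_card; apply/properP; split.
  apply/subsetP=> a; rewrite !inE /nu' /reroute ffunE => /andP[/eqP E na].
  rewrite na andbT.
  case: (eqVneq a x) => [ax|nax]; first by rewrite ax.
  case: (eqVneq a y) => [ay|nay]; first by rewrite ay /y (matchingK x muW).
  case: (eqVneq a (nu y)) => [az|naz]; last by rewrite E.
  have := congr1 mu E; rewrite (matchingK a muW) az (matchingK y nuW) /y (matchingK x muW).
  by move=> nuyx; have := congr1 nu nuyx; rewrite (matchingK y nuW) nux => yx; rewrite yx eqxx in nxy.
exists x; first by rewrite !inE /nu' /reroute ffunE eqxx eqxx.
by rewrite !inE negb_and nux -/y mux.
Qed.

(** A maximum matching never misses two adjacent vertices; [jointly_missed_trans] carries this along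
    a path, since every intermediate vertex is missed by some maximum matching. *)
Lemma connect_not_jointly_missed W :
  (forall t, t \in W -> exists2 nu, max_matching W nu & t \in missed W nu) ->
  forall u v, u \in W -> connect (restr W) u v -> u != v -> ~~ jointly_missed W u v.
Proof.
move=> all_missed u v uW /connectP[p]; elim/last_ind: p v => [|p z IH] v /=.
  by move=> _ ->; rewrite eqxx.
rewrite rcons_path last_rcons => /andP[pp /and3P[lW zW glz]] -> nuz.
have [Eu|nul] := eqVneq u (last u p).
  apply/negP=> /existsP[mu /andP[/andP[muM um] zm]].
  by have := max_matching_nonadj muM um zm nuz; rewrite {1}Eu glz.
have [Ez|nlz] := eqVneq (last u p) z.
  by rewrite -Ez; apply: IH.
apply: (@jointly_missed_trans W u (last u p) z nuz (all_missed _ lW)); first exact: IH.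
apply/negP=> /existsP[mu /andP[/andP[muM um] zm]].
by have := max_matching_nonadj muM um zm nlz; rewrite glz.
Qed.

Definition unmatch mu v : {ffun V -> V} :=
  [ffun a => if (a == v) || (a == mu v) then a else mu a].

Lemma unmatch_matching W mu v : matching W mu -> matching (W :\ v) (unmatch mu v).
Proof.
move=> mW; have K := fun a => matchingK a mW.
apply/matchingP; split=> a; rewrite /unmatch !ffunE.
  case: (eqVneq a v) => [->|nav] /=; first by rewrite eqxx.
  case: (eqVneq a (mu v)) => [->|nam] /=; first by rewrite eqxx orbT.
  case: (eqVneq (mu a) v) => [E|_] /=; first by rewrite -E K eqxx in nam.
  case: (eqVneq (mu a) (mu v)) => [E|_] //=.
  by rewrite -(K a) E K eqxx in nav.
case: (eqVneq a v) => [->|nav] /=; first by rewrite eqxx.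
case: (eqVneq a (mu v)) => [->|nam] /=; first by rewrite eqxx.
by move=> /(matching_edge mW)[h1 h2 h3]; rewrite !inE nav h1.
Qed.

Lemma missed_unmatch W mu v : matching W mu -> mu v != v ->
  missed (W :\ v) (unmatch mu v) = mu v |: missed W mu.
Proof.
move=> mW nv; have [vW mvW gv] := matching_edge mW nv.
apply/setP=> a; rewrite !inE /unmatch ffunE.
case: (eqVneq a v) => [->|nav] /=; first by rewrite eq_sym (negbTE nv) andbF.
by case: (eqVneq a (mu v)) => [->|nam] /=; rewrite ?mvW ?eqxx.
Qed.

(** [Y] represents components left by the barrier [X]. If every vertex is missed by some maximum
    matching, the previous lemma allows an empty barrier; otherwise a vertex covered by all of them
    joins the barrier, and its deletion raises the deficiency by exactly one. *)
Theorem tutte_berge W mu : max_matching W mu ->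
  exists X Y nu, [/\ X \subset W, matching (W :\: X) nu, Y = missed (W :\: X) nu,
    {in Y &, forall y1 y2, connect (restr (W :\: X)) y1 y2 -> y1 = y2}
    & #|Y| = #|X| + #|missed W mu| ].
Proof.
have [n le_n] := ubnP #|W|; elim: n W mu le_n => // n IH W mu le_n muM.
have /max_matchingP[muW muX] := muM.
have [/forall_inP H|] := boolP [forall (t | t \in W), [exists nu, max_matching W nu && (t \in missed W nu)]].
  exists set0, (missed W mu), mu; split; rewrite ?sub0set ?setD0 ?cards0 //.
  move=> y1 y2 h1 h2 c12; apply/eqP; apply: contraT => ny.
  have hall t : t \in W -> exists2 nu, max_matching W nu & t \in missed W nu.
    by case/H/existsP=> nu /andP[h3 h4]; exists nu.
  have y1W : y1 \in W by move: h1; rewrite inE => /andP[].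
  have /negP[] := connect_not_jointly_missed hall y1W c12 ny.
  by apply/existsP; exists mu; rewrite muM h1.
case/forall_inPn=> v vW; rewrite negb_exists => /forallP noM.
have nv : mu v != v.
  by have := noM mu; rewrite muM /= inE vW.
have unM : max_matching (W :\ v) (unmatch mu v).
  apply/max_matchingP; split; first exact: unmatch_matching.
  move=> nu nuW'; have nuW : matching W nu by apply: matching_sub nuW'; apply: subD1set.
  have nuv : nu v == v.
    by apply: contraT => /(matching_edge nuW')[]; rewrite !inE eqxx.
  have e1 : #|missed W nu| = #|missed (W :\ v) nu|.+1.
    rewrite (cardsD1 v) inE vW nuv; congr _.+1; apply: eq_card => a.
    by rewrite !inE andbA.
  rewrite missed_unmatch // cardsU1 inE (matchingK v muW) (eq_sym v) (negbTE nv) andbF /=.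
  (* A matching avoiding [v] is not maximum on [W]; by parity it misses at least two vertices more
     than [mu], one of which is [v]. *)
  have o1 := odd_missed nuW; have o2 := odd_missed muW.
  have : #|missed W mu| < #|missed W nu|.
    rewrite ltn_neqAle muX // andbT; apply/negP=> /eqP E.
    have /negP[] := noM nu; rewrite inE vW nuv !andbT; apply/max_matchingP.
    by split=> // k; rewrite -E; apply: muX.
  by rewrite e1 in o1 *; move: o1 o2 => /=; case: ltngtP => //; lia.
have le_n' : #|W :\ v| < n by move: le_n; rewrite (cardsD1 v) vW.
have [X [Y [nu [h1 h2 h3 h4 h5]]]] := IH _ _ le_n' unM.
have vX : v \notin X by apply/negP=> /(subsetP h1); rewrite !inE eqxx.
have e : W :\: (v |: X) = (W :\ v) :\: X.
  by apply/setP=> a; rewrite !inE negb_or; case: (a == v); rewrite ?andbF.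
exists (v |: X), Y, nu; rewrite e; split=> //.
  by apply/subsetP=> a; rewrite !inE => /orP[/eqP->//|/(subsetP h1)]; rewrite !inE => /andP[].
rewrite h5 cardsU1 vX missed_unmatch // cardsU1 inE (matchingK v muW) (eq_sym v) (negbTE nv) andbF /=.
by lia.
Qed.

End Matchings.

(** * Exact degree factors *)

Lemma card_pairs (T : finType) (A : {set T}) (P : T -> T -> bool) :
  #|[set p : T * T | (p.1 \in A) && P p.1 p.2]| = \sum_(v in A) #|[set w | P v w]|.
Proof.
rewrite -sum1_card (eq_bigl (fun p : T * T => (p.1 \in A) && P p.1 p.2)); last first.
  by move=> p; rewrite inE.
rewrite -(pair_big_dep (fun v => v \in A) (fun v w => P v w) (fun _ _ => 1)).
by apply: eq_bigr => v _; rewrite sum1dep_card.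
Qed.

Lemma card_enum_rank_lt (T : finType) k :
  k <= #|T| -> #|[set i : T | enum_rank i < k]| = k.
Proof.
move=> hk; have inj : injective (fun j : 'I_k => enum_val (widen_ord hk j)).
  by move=> i j /enum_val_inj E; apply: ord_inj; have := congr1 (@nat_of_ord _) E.
transitivity #|[set enum_val (widen_ord hk j) | j in 'I_k]|.
  apply: eq_card => i; rewrite inE; apply/idP/imsetP => [h|[j _ ->]]; last by rewrite enum_valK /= ltn_ord.
  by exists (Ordinal h) => //; rewrite -[LHS]enum_rankK; congr enum_val; apply: ord_inj.
by rewrite (card_imset _ inj) card_ord.
Qed.

Definition pairwise_disconnected (T : finType) (e : rel T) (P : {set T}) :=
  {in P &, forall x y, connect e x y -> x = y}.

Lemma connect_add_edge (T : finType) (e e' : rel T) x y :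
  symmetric e ->
  (forall a b, e' a b -> e a b \/ (a = x /\ b = y) \/ (a = y /\ b = x)) ->
  forall a b, connect e' a b ->
  connect e a b \/ (connect e a x || connect e a y) /\ (connect e b x || connect e b y).
Proof.
move=> es he' a b /connectP[p]; elim/last_ind: p b => [|p z IH] b /=.
  by move=> _ ->; left.
have cs := sym_connect_sym es.
rewrite rcons_path last_rcons => /andP[pp /he' e'lz] ->.
have {IH} := IH _ pp erefl.
case: e'lz => [elz|[[lx zy]|[ly zx]]].
- case=> [cl|[ca cl]]; first by left; apply: connect_trans cl (connect1 elz).
  right; split=> //; have czl : connect e z (last a p) by rewrite cs connect1.
  by case/orP: cl => /(connect_trans czl) ->; rewrite ?orbT.
- rewrite lx zy; case=> [->|[-> _]]; right; rewrite ?connect0 ?orbT //.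
- rewrite ly zx; case=> [->|[-> _]]; right; rewrite ?connect0 ?orbT //.
Qed.

Definition add_edges (T : finType) (e : rel T) (s : seq (T * T)) : rel T :=
  fun x y => [|| e x y, (x, y) \in s | (y, x) \in s].

Lemma add_edges_sym (T : finType) (e : rel T) s : symmetric e -> symmetric (add_edges e s).
Proof. by move=> es x y; rewrite /add_edges es orbCA orbC -!orbA; congr orb; rewrite orbC. Qed.

(** A new edge merges at most two classes, so it is enough to drop the element connected to one of
    its ends. *)
Lemma pairwise_disconnected_add (T : finType) (e : rel T) (s : seq (T * T)) (P : {set T}) :
  symmetric e -> pairwise_disconnected e P ->
  exists2 P' : {set T}, P' \subset P /\ #|P| <= #|P'| + size s & pairwise_disconnected (add_edges e s) P'.
Proof.
move=> es; elim: s => [|[x y] s IH] eP.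
  exists P; first by rewrite subxx addn0.
  move=> a b aP bP; rewrite (@eq_connect _ _ e); first exact: eP.
  by move=> u v; rewrite /add_edges !in_nil !orbF.
have [P' [sP' cP'] eP'] := IH eP.
have cs := sym_connect_sym (add_edges_sym s es).
exists (P' :\: [set c | connect (add_edges e s) c x]).
  split; first exact: subset_trans (subsetDl _ _) sP'.
  have := cardsID [set c | connect (add_edges e s) c x] P'.
  have : #|P' :&: [set c | connect (add_edges e s) c x]| <= 1.
    apply/card_le1_eqP=> a b; rewrite !inE => /andP[aP ca] /andP[bP cb].
    by apply: eP' => //; rewrite cs in ca; apply: connect_trans cb ca.
  by move=> /=; lia.
move=> a b; rewrite !inE => /andP[/negbTE nax aP] /andP[/negbTE nbx bP].
case/(@connect_add_edge _ (add_edges e s) _ x y (add_edges_sym s es)).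
- move=> u v; rewrite /add_edges !in_cons => /or3P[->|/orP[/eqP[-> ->]|->]|/orP[/eqP[-> ->]|->]];
    rewrite ?orbT; by auto.
- exact: eP'.
- rewrite nax nbx /= => -[ca cb]; rewrite cs in cb.
  by apply: eP' => //; apply: connect_trans ca cb.
Qed.

Section GraphFactor.
Variables (T : finType) (g : rel T).
Hypotheses (gsym : symmetric g) (girr : forall v, ~~ g v v).
Variable a : T -> nat.

Definition vdel (S : {set T}) : rel T := fun x y => (x \notin S) && (y \notin S) && g x y.

Definition components (S : {set T}) : {set {set T}} :=
  [set [set y | connect (vdel S) x y] | x in ~: S].

Lemma vdel_sym S : symmetric (vdel S).
Proof. by move=> x y; rewrite /vdel gsym (andbC (x \notin S)). Qed.

Lemma pairwise_disconnected_components (S P : {set T}) :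
  P \subset ~: S -> pairwise_disconnected (vdel S) P -> #|P| <= #|components S|.
Proof.
move=> sP eP; rewrite -(@card_in_imset _ _ (fun x => [set y | connect (vdel S) x y]) P).
  by apply/subset_leq_card/imsetS.
by move=> x y xP yP /setP/(_ y); rewrite !inE connect0 => /eP; apply.
Qed.

Definition dg v := #|[set w | g v w]|.
Definition dg_out (A : {set T}) v := #|[set w | g v w && (w \notin A)]|.

Let V := (T * T + T * T)%type.

(* Tutte's gadget: [inl (v, w)] is the end at [v] of the edge [vw], and [inr (v, i)],
   for [dg v - a v] indices [i], absorbs an end at [v] that is not used by the factor. *)
Definition gadget : rel V := fun p q =>
  match p, q with
  | inl (v, w), inl (v', w') => (v' == w) && (w' == v)
  | inl (v, _), inr (v', _) => v == v'
  | inr (v, _), inl (v', _) => v == v'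
  | inr _, inr _ => false
  end.

(** Elements of [T] of small rank serve as indices of the absorbers, which avoids an index type
    depending on [v]; there are enough of them because [dg v <= #|T|]. *)
Definition gadget_vertices : {set V} :=
  [set p | match p with inl (v, w) => g v w | inr (v, i) => enum_rank i < dg v - a v end].

Definition base (p : V) : T := match p with inl (v, _) | inr (v, _) => v end.

Lemma gadget_sym : symmetric gadget.
Proof.
move=> [[v w]|[v i]] [[v' w']|[v' i']] //=; first by rewrite andbC (eq_sym w') (eq_sym v').
all: exact: eq_sym.
Qed.

(** A perfect matching pairs the absorbers at [v] with precisely the ends at [v] that are not
    matched along their own edge. So [dg v - a v] edges at [v] are left out. *)
Lemma gadget_factor (mu : {ffun V -> V}) :
  (forall v, a v <= dg v) ->
  matching gadget gadget_vertices mu -> missed gadget_vertices mu = set0 ->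
  exists h : rel T, [/\ symmetric h, subrel h g & forall v, #|[set w | h v w]| = a v].
Proof.
move=> ad muM mu0; pose h v w := g v w && (mu (inl (v, w)) == inl (w, v)).
have cov p : p \in gadget_vertices -> mu p != p.
  by move=> pV; apply: contraT; rewrite negbK => mp; have := in_set0 p; rewrite -mu0 inE pV mp.
exists h; split.
- move=> v w; rewrite /h gsym; congr andb.
  by apply/eqP/eqP => <-; rewrite (matchingK _ muM).
- by move=> v w /andP[].
move=> v; pose c w := g v w && ~~ h v w.
have e1 : #|[set w | h v w]| + #|[set w | c w]| = dg v.
  rewrite /dg -[RHS](cardsID [set w | h v w]); congr (_ + _); apply: eq_card => w; rewrite !inE.
    by rewrite /h; case: (g v w).
  by rewrite /c andbC.
suff e2 : #|[set w | c w]| = dg v - a v by have := ad v; lia.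
have dT : dg v - a v <= #|T| by apply: leq_trans (leq_subr _ _) (max_card _).
rewrite -(card_enum_rank_lt dT).
have i1 : injective (fun w : T => inl (v, w) : V) by move=> w w' [].
have i2 : injective (fun w : T => inr (v, w) : V) by move=> w w' [].
rewrite -(card_imset _ i1) -(card_imset [set i : T | _] i2) -(card_imset _ (can_inj (fun p => matchingK p muM))).
apply: eq_card => p; apply/imsetP/imsetP => [[q /imsetP[w cw ->] ->]|[i]].
  move: cw; rewrite inE /c /h => /andP[gvw]; rewrite gvw /= => nh.
  have pV : inl (v, w) \in gadget_vertices by rewrite inE.
  have [_ mV gm] := matching_edge muM (cov _ pV).
  move: mV gm nh; case: (mu _) => [[v' w']|[v' i]] /=.
    by move=> _ /andP[/eqP-> /eqP->]; rewrite eqxx.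
  by rewrite inE => hi /eqP vv _; exists i; rewrite ?inE vv.
rewrite inE => hi ->; have pV : inr (v, i) \in gadget_vertices by rewrite inE.
have [_ mV gm] := matching_edge muM (cov _ pV).
exists (mu (inr (v, i))); last by rewrite (matchingK _ muM).
move: mV gm (matchingK (inr (v, i)) muM); case: (mu _) => [[v' w]|[v' w]] //=.
rewrite inE => gw /eqP vv' E; subst v'; apply/imsetP; exists w => //.
by rewrite inE /c /h gw E /=.
Qed.

(** * A barrier of Tutte's gadget read in the graph *)

Section Barrier.
Variables (X Y : {set V}) (nu : {ffun V -> V}).
Hypothesis ad : forall v, a v <= dg v.
Hypothesis nuM : matching gadget (gadget_vertices :\: X) nu.
Hypothesis YE : Y = missed (gadget_vertices :\: X) nu.
Hypothesis Ydis : {in Y &, forall y1 y2,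
   connect (restr gadget (gadget_vertices :\: X)) y1 y2 -> y1 = y2}.

(** The two ways in which a barrier breaks up the gadget at a vertex. Anywhere else an end and an
    absorber survive, and since all ends are joined to all absorbers, what survives there is
    connected. *)
Let A := [set v | [forall w, g v w ==> (inl (v, w) \in X)]].
Let B := [set v | (v \notin A) &&
                  [forall i, (inr (v, i) \in gadget_vertices) ==> (inr (v, i) \in X)]].

Lemma disjoint_AB : [disjoint A & B].
Proof. by rewrite -setI_eq0; apply/eqP/setP=> v; rewrite /B !inE andbA andbN. Qed.

Let link := restr gadget (gadget_vertices :\: X).

Lemma link_connect_sym : connect_sym link.
Proof.
apply: sym_connect_sym => p q; rewrite /link /restr gadget_sym.
by rewrite andbCA.
Qed.

Lemma Y_mem p : p \in Y -> p \in gadget_vertices /\ p \notin X.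
Proof. by rewrite YE !inE => /andP[/andP[]]. Qed.

Lemma end_notin_A v w : inl (v, w) \in gadget_vertices -> inl (v, w) \notin X -> v \notin A.
Proof.
by move=> h; apply: contra; rewrite inE => /forallP/(_ w)/implyP; apply; rewrite inE in h.
Qed.

Lemma core_notin_B v i : inr (v, i) \in gadget_vertices -> inr (v, i) \notin X -> v \notin B.
Proof.
by move=> h; apply: contra; rewrite inE => /andP[_ /forallP/(_ i)/implyP]; apply.
Qed.

Lemma rest_connect v p q :
  v \notin A -> v \notin B ->
  base p == v ->
  base q == v ->
  p \in gadget_vertices :\: X -> q \in gadget_vertices :\: X -> connect link p q.
Proof.
move=> vA vB.
have [w0 [gw0 w0X]] : exists w, g v w /\ inl (v, w) \notin X.
  move: (vA); rewrite inE negb_forall => /existsP[w]; rewrite negb_imply => /andP[h1 h2].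
  by exists w.
have [i0 [gi0 i0X]] : exists i, inr (v, i) \in gadget_vertices /\ inr (v, i) \notin X.
  move: (vB); rewrite inE vA /= negb_forall => /existsP[i]; rewrite negb_imply => /andP[h1 h2].
  by exists i.
have i0V : inr (v, i0) \in gadget_vertices :\: X by rewrite in_setD i0X.
have w0V : inl (v, w0) \in gadget_vertices :\: X by rewrite in_setD w0X inE.
have toi p' : base p' == v ->
   p' \in gadget_vertices :\: X -> connect link p' (inr (v, i0)).
  case: p' => [[u w]|[u i]] /= /eqP-> pV.
    by apply: connect1; rewrite /link /restr pV i0V /= eqxx.
  apply: (@connect_trans _ _ (inl (v, w0))); apply: connect1; rewrite /link /restr ?pV ?i0V w0V /= ?eqxx //.
by move=> h1 h2 pV qV; apply: connect_trans (toi _ h1 pV) _; rewrite link_connect_sym toi.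
Qed.

(** A surviving end at a vertex of [B] has lost all absorbers; its component can continue only
    through the opposite end, so it is located at the other vertex of the edge. *)
Let anchor (p : V) : T :=
  match p with inl (v, w) => if v \in B then w else v | inr (v, _) => v end.

(** [Y1] and [Y2] consist of vertices isolated by the barrier; every other point of [Y] is charged
    to a component of the graph outside [A] and [B]. *)
Let Y1 := [set p in Y | match p with inl _ => false | inr (v, _) => v \in A end].
Let Y2 := [set p in Y | match p with inl (v, w) => (v \in B) && (inl (w, v) \in X)
                                 | inr _ => false end].
Let Y3 := Y :\: (Y1 :|: Y2).

Lemma Y3_cases p : p \in Y3 ->
  [/\ anchor p \notin A, anchor p \notin B &
   exists q, [/\ q \in gadget_vertices :\: X, connect link p q &
     base q == anchor p]].
Proof.
rewrite in_setD in_setU negb_or => /andP[/andP[]]; rewrite in_set => n1; rewrite in_set => n2 pY.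
rewrite pY /= in n1 n2.
have [pV pX] := Y_mem pY; have pVX : p \in gadget_vertices :\: X by rewrite in_setD pX.
case: p pY pV pX pVX n1 n2 => [[v w]|[v i]] pY pV pX pVX /= n1 n2; last first.
  split=> //; first exact: core_notin_B pV pX.
  by exists (inr (v, i)); rewrite connect0 eqxx.
have vA := end_notin_A pV pX.
case: ifP n2 => /= [vB wX|/negbT vB _]; last first.
  by split=> //; exists (inl (v, w)); rewrite connect0 eqxx.
have wvV : inl (w, v) \in gadget_vertices by move: pV; rewrite !inE gsym.
have wvVX : inl (w, v) \in gadget_vertices :\: X by rewrite in_setD wX.
have lk : connect link (inl (v, w)) (inl (w, v)).
  by apply: connect1; rewrite /link /restr pVX wvVX /= !eqxx.
have wA := end_notin_A wvV wX.
split=> //; last by exists (inl (w, v)).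
(* If both ends of the edge sat at vertices of [B], they would form a component by themselves. One
   is missed, so the other is not in [Y] and must be matched, but it has no other partner left. *)
apply/negP=> wB.
have nvw : v != w.
  by apply/eqP=> E; move: pV; rewrite inE E (negbTE (girr w)).
have nwvY : inl (w, v) \notin Y.
  by apply/negP=> h; have [E _] := Ydis pY h lk; rewrite E eqxx in nvw.
have nuwv : nu (inl (w, v)) != inl (w, v).
  by apply: contra nwvY => h; rewrite YE inE wvVX h.
have [_ qV gq] := matching_edge nuM nuwv.
move: qV gq (matchingK (inl (w, v)) nuM); case: (nu _) => [[v' w']|[v' i]] /=.
  move=> _ /andP[/eqP-> /eqP->] E; move: pY; rewrite YE inE E => /andP[_ /eqP[E2 _]].
  by rewrite E2 eqxx in nvw.
rewrite in_setD => /andP[h1 h2] /eqP E _; subst v'.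
by have := core_notin_B h2 h1; rewrite wB.
Qed.

Let e0 : rel T := fun x y =>
  [&& vdel (A :|: B) x y, inl (x, y) \notin X & inl (y, x) \notin X].

Lemma e0_sym : symmetric e0.
Proof. by move=> x y; rewrite /e0 vdel_sym (andbC (inl (x, y) \notin X)). Qed.

Lemma e0_link x y p q : x \notin A -> x \notin B -> connect e0 x y ->
  base p == x ->
  base q == y ->
  p \in gadget_vertices :\: X -> q \in gadget_vertices :\: X -> connect link p q.
Proof.
move=> xA xB /connectP[s]; elim: s x p xA xB => [|z s IH] x p xA xB /=.
  by move=> _ ->; apply: rest_connect.
case/andP=> /and3P[/andP[/andP[_ zAB] gxz] xzX zxX] ps ly px qy pV qV.
move: zAB; rewrite in_setU negb_or => /andP[zA zB].
have xzV : inl (x, z) \in gadget_vertices :\: X by rewrite in_setD xzX inE.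
have zxV : inl (z, x) \in gadget_vertices :\: X by rewrite in_setD zxX inE gsym.
apply: connect_trans (_ : connect link p (inl (x, z))) _.
  by apply: (@rest_connect x) => //=.
apply: connect_trans (_ : connect link (inl (x, z)) (inl (z, x))) _.
  by apply: connect1; rewrite /link /restr xzV zxV /= !eqxx.
exact: (IH z).
Qed.

Lemma Y3_connect p q : p \in Y3 -> q \in Y3 -> connect e0 (anchor p) (anchor q) -> p = q.
Proof.
move=> pY qY; have [pA pB [p' [pV pl pa]]] := Y3_cases pY.
have [qA qB [q' [qV ql qa]]] := Y3_cases qY => c.
have pYY : p \in Y by move: pY; rewrite in_setD => /andP[].
have qYY : q \in Y by move: qY; rewrite in_setD => /andP[].
apply: Ydis => //; apply: connect_trans pl _.
apply: (@connect_trans _ _ q'); last by rewrite link_connect_sym.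
exact: e0_link pA pB c pa qa pV qV.
Qed.

(** [E1] to [E4] index disjoint parts of the barrier. [E3] and [E4] return as costs in the bounds
    for [Y2] and [Y3] and cancel there, so that only degrees remain. *)
Let E1 := [set p : T * T | (p.1 \in A) && g p.1 p.2].
Let E2 := [set p : T * T | (p.1 \in B) && (enum_rank p.2 < dg p.1 - a p.1)].
Let E3 := [set p : T * T | [&& p.1 \notin A, p.2 \in B & inl p \in X]].
Let E4 := [set p : T * T | [&& p.1 \notin A :|: B, p.2 \notin A :|: B & inl p \in X]].
Let E5 := [set p : T * T | (p.1 \in B) && (g p.1 p.2 && (p.2 \in A))].

(* An end in [X] of an edge avoiding [A] and [B] splits at most one component. *)
Lemma card_Y3 : #|Y3| <= #|components (A :|: B)| + #|E4|.
Proof.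
have inj : {in Y3 &, injective anchor}.
  by move=> p q pY qY E; apply: Y3_connect => //; rewrite E connect0.
have Pd : pairwise_disconnected e0 (anchor @: Y3).
  move=> x y /imsetP[p pY ->] /imsetP[q qY ->] c.
  by rewrite (Y3_connect pY qY c).
rewrite -(card_in_imset inj).
have [P' [sP' leP'] dP'] := pairwise_disconnected_add (enum E4) e0_sym Pd.
apply: (leq_trans leP'); rewrite -cardE leq_add2r.
apply: pairwise_disconnected_components.
  apply/subsetP=> x /(subsetP sP')/imsetP[p pY ->].
  by have [h1 h2 _] := Y3_cases pY; rewrite in_setC in_setU negb_or h1.
move=> x y xP yP c; apply: dP' => //; apply: connect_sub c => u v uv.
apply: connect1; move: (uv); rewrite /vdel => /andP[/andP[uS vS] guv].
rewrite /add_edges !mem_enum /e0 uv /= ![_ \in E4]inE uS vS /=.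
by case: (inl (u, v) \in X); case: (inl (v, u) \in X).
Qed.

Lemma card_X : #|E1| + #|E3| + #|E4| + #|E2| <= #|X|.
Proof.
have i1 : injective (inl : T * T -> V) by move=> p q [].
have i2 : injective (inr : T * T -> V) by move=> p q [].
rewrite -(cardsID [set inl p | p in [set: T * T]] X).
apply: leq_add.
  rewrite -(cardsUI E1 E3) (_ : E1 :&: E3 = set0) ?cards0 ?addn0; last first.
    by apply/setP=> p; rewrite !inE; case: [forall _, _]; rewrite ?andbF.
  rewrite -(cardsUI _ E4) (_ : (E1 :|: E3) :&: E4 = set0) ?cards0 ?addn0; last first.
    apply/eqP; rewrite -subset0; apply/subsetP=> p; rewrite in_setI in_setU ![p \in E1]in_set [p \in E3]in_set [p \in E4]in_set !in_setU !negb_or.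
    by case: (p.1 \in A) => //=; case: (p.2 \in B); rewrite //= ?andbF ?orbF.
  rewrite -(card_imset _ i1); apply/subset_leq_card/subsetP=> _ /imsetP[p hp ->].
  rewrite in_setI imset_f ?inE // andbT.
  move: hp; rewrite 2!in_setU => /orP[/orP[]|]; rewrite in_set.
  - by case: p => v w /andP[/=]; rewrite in_set => /forallP/(_ w)/implyP.
  - by case/and3P.
  - by case/and3P.
rewrite -(card_imset _ i2); apply/subset_leq_card/subsetP=> _ /imsetP[[v i] hp ->].
move: hp; rewrite in_set /= => /andP[]; rewrite in_set => /andP[_ /forallP/(_ i)/implyP h] hi.
rewrite in_setD h ?inE // andbT; apply/imsetP=> -[p _] //.
Qed.

Lemma card_Y1 : #|Y1| <= \sum_(v in A) (dg v - a v).
Proof.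
have i2 : injective (inr : T * T -> V) by move=> p q [].
apply: (@leq_trans #|[set p : T * T | (p.1 \in A) && (enum_rank p.2 < dg p.1 - a p.1)]|).
  rewrite -(card_imset _ i2); apply/subset_leq_card/subsetP=> p; rewrite in_set => /andP[].
  move=> /Y_mem[pV _]; case: p pV => [[v w]|[v i]] // pV vA.
  by apply/imsetP; exists (v, i) => //; rewrite in_set vA; rewrite in_set in pV.
rewrite (card_pairs A (fun v i => enum_rank i < dg v - a v)).
apply: leq_sum => v _; rewrite card_enum_rank_lt //.
by apply: leq_trans (leq_subr _ _) (max_card _).
Qed.

Lemma card_Y2 : #|Y2| <= #|E5| + #|E3|.
Proof.
pose sw (p : T * T) : V := inl (p.2, p.1).
have i1 : injective (inl : T * T -> V) by move=> p q [].
have i2 : injective sw by move=> [p q] [p' q'] [-> ->].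
rewrite -(card_imset E5 i1) -(card_imset E3 i2).
apply: leq_trans (leq_card_setU _ _); apply/subset_leq_card/subsetP=> p.
rewrite in_set => /andP[/Y_mem[pV _]]; case: p pV => [[v w]|[v i]] // pV /andP[vB wvX].
have [wA|wA] := boolP (w \in A).
  rewrite in_setU; apply/orP; left; apply/imsetP; exists (v, w) => //.
  by rewrite in_set vB wA /= andbT; rewrite in_set in pV.
by rewrite in_setU orbC; apply/orP; left; apply/imsetP; exists (w, v) => //; rewrite in_set wA vB.
Qed.

(** The excess of [Y] over [X] becomes the deficiency in Tutte's condition: absorbers at [A] are
    weighed against the ends at [A], and ends from [B] to [A] against the absorbers at [B]. *)
Lemma barrier_count :
  #|Y| + \sum_(v in A) a v + \sum_(v in B) dg_out A v
  <= #|X| + \sum_(v in B) a v + #|components (A :|: B)|.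
Proof.
have dT v : dg v - a v <= #|T| by apply: leq_trans (leq_subr _ _) (max_card _).
have e1 : #|E1| = \sum_(v in A) dg v by rewrite /E1 (card_pairs A g).
have e2 : #|E2| = \sum_(v in B) (dg v - a v).
  rewrite /E2 (card_pairs B (fun v i => enum_rank i < dg v - a v)).
  by apply: eq_bigr => v _; rewrite card_enum_rank_lt.
have e5 : #|E5| + \sum_(v in B) dg_out A v = \sum_(v in B) dg v.
  rewrite /E5 (card_pairs B (fun v w => g v w && (w \in A))) -big_split /=.
  apply: eq_bigr => v _; rewrite /dg /dg_out -[RHS](cardsID A).
  by congr (_ + _); apply: eq_card => w; rewrite !inE // andbC.
have sA : \sum_(v in A) (dg v - a v) + \sum_(v in A) a v = \sum_(v in A) dg v.
  by rewrite -big_split; apply: eq_bigr => v _; rewrite /= subnK.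
have sB : \sum_(v in B) (dg v - a v) + \sum_(v in B) a v = \sum_(v in B) dg v.
  by rewrite -big_split; apply: eq_bigr => v _; rewrite /= subnK.
have := card_Y1; have := card_Y2; have := card_Y3; have := card_X.
have : #|Y| <= #|Y1| + #|Y2| + #|Y3|.
  rewrite -(cardsID (Y1 :|: Y2) Y) leq_add2r; apply: leq_trans (leq_card_setU _ _).
  exact/subset_leq_card/subsetIr.
lia.
Qed.

End Barrier.

(** All components are counted instead of the odd ones, and a deficiency of one is tolerated: the
    number of missed gadget vertices has the parity of the sum of [a], so it is 0 or at least 2. *)
Theorem exact_factor :
  (forall v, a v <= dg v) -> ~~ odd (\sum_v a v) ->
  (forall A B : {set T}, [disjoint A & B] ->
     \sum_(v in B) a v + #|components (A :|: B)|
     < \sum_(v in A) a v + \sum_(v in B) dg_out A v + 2) ->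
  exists h : rel T, [/\ symmetric h, subrel h g & forall v, #|[set w | h v w]| = a v].
Proof.
move=> ad ev cond; have [mu muM] := max_matching_exists gadget gadget_vertices.
have /max_matchingP[muW _] := muM.
have [m0|m0] := eqVneq (missed gadget_vertices mu) set0.
  exact: (gadget_factor ad muW m0).
have m2 : 2 <= #|missed gadget_vertices mu|.
  have : 0 < #|missed gadget_vertices mu| by rewrite card_gt0.
  suff : ~~ odd #|missed gadget_vertices mu| by case: #|_| => [|[|]].
  rewrite (odd_missed muW).
  have dT v : dg v - a v <= #|T| by apply: leq_trans (leq_subr _ _) (max_card _).
  have -> : #|gadget_vertices| = \sum_v dg v + \sum_v (dg v - a v).
    have i1 : injective (inl : T * T -> V) by move=> p q [].
    have i2 : injective (inr : T * T -> V) by move=> p q [].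
    rewrite -(cardsID [set inl p | p in [set: T * T]] gadget_vertices); congr (_ + _).
      rewrite (_ : \sum_v dg v = \sum_(v in [set: T]) dg v); last by apply: eq_bigl => v; rewrite inE.
      rewrite -(card_pairs [set: T] g) -(card_imset _ i1); apply: eq_card => p.
      rewrite in_setI; apply/andP/imsetP => [[h /imsetP[q _ E]]|[q hq ->]].
        by exists q => //; move: h; rewrite E !in_set; case: q {E}.
      split; last exact: imset_f.
      by move: hq; rewrite !in_set; case: q.
    transitivity (\sum_(v in [set: T]) #|[set i : T | enum_rank i < dg v - a v]|); last first.
      by apply: eq_big => [v|v _]; rewrite ?inE // card_enum_rank_lt.
    rewrite -(card_pairs [set: T] (fun v i => enum_rank i < dg v - a v)) -(card_imset _ i2).
    apply: eq_card => p; rewrite in_setD; apply/andP/imsetP => [[h1 h2]|[q hq ->]].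
      case: p h1 h2 => [p|[v i]] h1 h2; first by rewrite imset_f in h1.
      by exists (v, i) => //; move: h2; rewrite !in_set.
    split; first by apply/imsetP=> -[].
    by move: hq; rewrite !in_set; case: q.
  have : \sum_v (dg v - a v) + \sum_v a v = \sum_v dg v.
    by rewrite -big_split; apply: eq_bigr => v _; rewrite /= subnK.
  by move: ev; lia.
have [X [Y [nu [h1 h2 h3 h4 h5]]]] := tutte_berge gadget_sym muM.
have := barrier_count ad h2 h3 h4; have := cond _ _ (disjoint_AB X).
move=> c1; rewrite h5 -!addnA leq_add2l !addnA => c2; exfalso; move: m2 c1 c2.
move: #|missed _ _| => k; move: (\sum_(v in _) a v) => x1.
move: (\sum_(v in _) a v) => x2; move: (\sum_(v in _) _) => x3; move: #|_| => x4.
by clear; lia.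
Qed.

End GraphFactor.

(** * Factors of tough graphs *)

(** Greedy choice: a heaviest vertex of [B] pays for itself and for its neighbours in [B], which are
    discarded. *)
Lemma weighted_independent_set (T : finType) (g : rel T) (wt : T -> nat) (B : {set T}) :
  symmetric g -> (forall v, ~~ g v v) ->
  exists I : {set T}, [/\ I \subset B, {in I &, forall x y, ~~ g x y} &
    \sum_(v in B) wt v <= \sum_(v in I) (#|[set w in B | g v w]|).+1 * wt v].
Proof.
move=> gsym girr; have [n le_n] := ubnP #|B|; elim: n B le_n => // n IH B le_n.
have [->|[u0 u0B]] := set_0Vmem B.
  exists set0; rewrite !big_set0 sub0set; split=> //.
  by move=> x y; rewrite inE.
have [u uB0 umax] := arg_maxnP wt u0B; have uB : u \in B := uB0.
pose B' := [set w in B | (w != u) && ~~ g u w].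
have sB : B' \subset B by apply/subsetP=> w; rewrite inE => /andP[].
have uB' : u \notin B' by rewrite inE eqxx andbF.
have ltB : #|B'| < n.
  have : B' \proper B by apply/properP; split=> //; exists u.
  by move/proper_card; lia.
have [I [sI indI leI]] := IH _ ltB.
have uI : u \notin I by apply: contra uB'; apply: (subsetP sI).
exists (u |: I); split.
- by apply/subsetP=> x /setU1P[->|/(subsetP sI)/(subsetP sB)].
- have gu x : x \in I -> ~~ g u x.
    by move/(subsetP sI); rewrite inE => /and3P[].
  move=> x y /setU1P[->|xI] /setU1P[->|yI] //; first exact: gu.
    by rewrite gsym gu.
  exact: indI.
rewrite (big_setU1 _ uI) /= (bigID [pred w | w \in B']) /= addnC; apply: leq_add.
  apply: (@leq_trans (\sum_(v in u |: [set w in B | g u w]) wt u)); last first.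
    by rewrite sum_nat_const leq_mul2r cardsU1 inE (negbTE (girr u)) andbF leqnn orbT.
  rewrite big_mkcond [leqRHS]big_mkcond; apply: leq_sum => v _.
  rewrite !inE; case: (boolP (v \in B)) => vB /=.
    by case: (eqVneq v u) => [->|] //=; case: (g u v) => //=; move=> _; exact: (umax v vB).
  by [].
rewrite (eq_bigl (mem B')); last first.
  by move=> v; rewrite /= andbC; case: (boolP (v \in B')) => // /(subsetP sB) ->.
apply: leq_trans leI _; apply: leq_sum => v _.
rewrite leq_mul2r ltnS subset_leq_card ?orbT //.
by apply/subsetP=> w; rewrite !inE => /andP[/andP[-> _] ->].
Qed.

Section NearFactor.
Variables (T : finType) (g : rel T) (f : T -> nat).
Hypotheses (gsym : symmetric g) (girr : forall v, ~~ g v v).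
Hypothesis f_gt1 : forall v, 1 < f v.

Definition isolated_in (S : {set T}) : {set T} :=
  [set v | (v \notin S) && [forall y, ~~ vdel g S v y]].

Hypothesis isolated_toughness : forall S, \sum_(v in isolated_in S) f v * (f v).+1 <= #|S|.
Hypothesis connected_graph : #|components g set0| <= 1.
Hypothesis tough : forall S, S != set0 -> 2 * #|components g S| < #|S| + 2.

(* The summand 1 pays for the half component that toughness charges to each vertex of [B]. *)
Lemma degree_deficiency (A B : {set T}) : [disjoint A & B] ->
  \sum_(v in B | dg_out g A v <= f v) (2 * (f v - dg_out g A v)).+1 <= 2 * #|A|.
Proof.
move=> dAB; pose d := dg_out g A; pose B0 := [set v in B | d v <= f v].
have BA v : v \in B -> v \notin A by move=> vB; rewrite (disjointFl dAB).
pose wt v := (2 * (f v - d v)).+1.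
have [I [sI indI leI]] := weighted_independent_set wt B0 gsym girr.
rewrite (eq_bigl (mem B0)) => [|v]; last by rewrite !inE.
apply: leq_trans leI _.
(* Deleting [A] and the remaining neighbours of the independent set [I] isolates [I], at a cost of
   at most [d v] for each [v] in [I]. *)
pose S := A :|: \bigcup_(v in I) [set w | g v w && (w \notin A)].
have IB0 v : v \in I -> (v \in B) && (d v <= f v) by move/(subsetP sI); rewrite inE.
have leS : #|S| <= #|A| + \sum_(v in I) d v.
  apply: (leq_trans (leq_card_setU _ _)); rewrite leq_add2l.
  pose P (X : {set T}) n := #|X| <= n.
  apply: (big_ind2 P); rewrite /P ?cards0 // => X1 n1 X2 n2 h1 h2.
  by apply: (leq_trans (leq_card_setU _ _)); apply: leq_add.
have isoI : \sum_(v in I) f v * (f v).+1 <= #|S|.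
  apply: leq_trans (isolated_toughness S); rewrite [leqRHS](bigID (mem I)) /=.
  apply: leq_trans (leq_addr _ _); rewrite [leqRHS](eq_bigl (mem I)) // => v /=.
  rewrite andbC; case: (boolP (v \in I)) => //= vI.
  have /andP[vB _] := IB0 _ vI.
  rewrite inE; apply/andP; split.
    rewrite in_setU (negbTE (BA _ vB)) /=; apply/bigcupP=> -[u uI].
    by rewrite inE (negbTE (indI _ _ uI vI)).
  apply/forallP=> y; apply/negP=> /andP[/andP[_ yS] gvy]; case/negP: yS.
  rewrite in_setU; case: (boolP (y \in A)) => //= yA.
  by apply/bigcupP; exists v => //; rewrite inE gvy.
(* The origin of the weight [f (f + 1)]: a vertex of [I] has at most [d v] neighbours in [B0], and
   [(d + 1)(2(f - d) + 1) + 2d <= 2f(f + 1)] for [d <= f]. *)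
suff : \sum_(v in I) (#|[set w in B0 | g v w]|.+1 * wt v + 2 * d v)
       <= \sum_(v in I) 2 * (f v * (f v).+1).
  rewrite big_split -!big_distrr /=; lia.
apply: leq_sum => v vI; have /andP[vB dv] := IB0 _ vI.
have le_d : #|[set w in B0 | g v w]| <= d v.
  apply/subset_leq_card/subsetP=> w; rewrite !inE => /andP[/andP[wB _] ->].
  by rewrite BA.
have := f_gt1 v; rewrite /wt.
move: le_d dv; move: #|_| (d v) (f v) => k e x ke ex x1.
have [y E] : exists y, x = e + y by exists (x - e); lia.
subst x.
rewrite addKn; apply: (@leq_trans (e.+1 * (2 * y).+1 + 2 * e)).
  by rewrite leq_add2r leq_mul2r ltnS ke orbT.
have sq n : n <= n * n by case: n => // n; apply: leq_pmulr.
by move: (sq e) (sq y); clear -x1; nia.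
Qed.

Theorem near_factor :
  exists (h : rel T) (D : {set T}), [/\ symmetric h, subrel h g, #|D| <= 1 &
    forall v, #|[set w | h v w]| = f v + (v \in D)].
Proof.
(* Deleting the neighbourhood of [v] isolates [v]. *)
have deg_big v : f v * (f v).+1 <= dg g v.
  have := isolated_toughness [set w | g v w]; rewrite (bigD1 v) /=; last first.
    rewrite !inE girr /=; apply/forallP=> y; rewrite /vdel !inE girr /=.
    by case: (g v y).
  by rewrite /dg; apply: leq_trans; apply: leq_addr.
have [D D1 Dev] : exists2 D : {set T}, #|D| <= 1 & ~~ odd (\sum_v (f v + (v \in D))).
  have sD (D : {set T}) : \sum_v (f v + (v \in D)) = \sum_v f v + #|D|.
    have -> : #|D| = \sum_v (v \in D : nat); last by rewrite big_split.
    by rewrite -sum1_card big_mkcond; apply: eq_bigr => v _; case: (v \in D).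
  case: (boolP (odd (\sum_v f v))) => od; last by exists set0; rewrite ?sD cards0 ?addn0.
  case: (pickP (@predT T)) => [v _|T0]; last by rewrite big_pred0 in od.
  by exists [set v]; rewrite ?sD cards1 // oddD od.
have [|A B dAB|h [hs hg hd]] := @exact_factor _ g gsym girr (fun v => f v + (v \in D)) _ Dev.
- move=> v; apply: leq_trans (deg_big v); have := f_gt1 v.
  by case: (v \in D); nia.
- have [E|nE] := eqVneq (A :|: B) set0.
    have [-> ->] : A = set0 /\ B = set0.
      by move/eqP: E; rewrite setU_eq0 => /andP[/eqP-> /eqP->].
    by rewrite !big_set0 setU0 !add0n ltnS.
  (* After doubling, the components cost less than [#|A| + #|B| + 2] and the exceptional vertex at
     most 2. [degree_deficiency] absorbs [#|B|] at the price [2 * #|A|], while [A] contributes at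
     least [4 * #|A|]. *)
  have tAB := tough nE; have cAB := leq_of_leqif (leq_card_setU A B).
  have sB : \sum_(v in B) (f v + (v \in D)) <= \sum_(v in B) f v + 1.
    rewrite big_split leq_add2l /=; apply: leq_trans D1.
    rewrite -sum1_card [leqRHS]big_mkcond [leqLHS]big_mkcond /=; apply: leq_sum => v _.
    by case: (v \in B); case: (v \in D).
  have sA : 2 * #|A| <= \sum_(v in A) (f v + (v \in D)).
    rewrite mulnC -sum_nat_const; apply: leq_sum => v _.
    exact: leq_trans (f_gt1 v) (leq_addr _ _).
  have def := degree_deficiency dAB.
  have pw : \sum_(v in B) (2 * f v + 1) <=
    \sum_(v in B) 2 * dg_out g A v + \sum_(v in B | dg_out g A v <= f v) (2 * (f v - dg_out g A v)).+1.
    rewrite big_mkcondr -big_split /=; apply: leq_sum => v _.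
    by case: (leqP (dg_out g A v) (f v)) => h; lia.
  move: pw; rewrite big_split -!big_distrr /= sum1_card; move: tAB cAB sB sA def.
  move: #|components _ _| #|A :|: B| #|A| #|B| => c1 c2 c3 c4.
  move: (\sum_(v in B) (f v + _)) (\sum_(v in A) _) (\sum_(v in B | _) _) (\sum_(v in B) f v) => x1 x2 x3 x4.
  by move: (\sum_(v in B) _) => x5; clear; lia.
- by exists h, D.
Qed.

End NearFactor.

(** * Sparse and tight sets *)

Section Sparse.
Variables (T E : finType) (ends : E -> T * T) (m : nat).
Implicit Types (X Y : {set E}) (U Z : {set T}) (e d : E).

Definition inside U : {set E} := [set e | ((ends e).1 \in U) && ((ends e).2 \in U)].

(** By Nash-Williams these are the unions of [m] disjoint forests, that is, the independent sets of
    a matroid; the additive form avoids truncated subtraction. *)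
Definition sparse X : bool :=
  [forall U : {set T}, (U != set0) ==> (#|X :&: inside U| + m <= m * #|U|)].

Definition tight X U : bool := (U != set0) && (#|X :&: inside U| + m == m * #|U|).

Lemma sparseP X :
  reflect (forall U, U != set0 -> #|X :&: inside U| + m <= m * #|U|) (sparse X).
Proof.
by apply: (iffP forallP) => H U; [apply/implyP | apply/implyP => /H].
Qed.

Lemma insideS U Z : U \subset Z -> inside U \subset inside Z.
Proof.
by move=> /subsetP s; apply/subsetP=> e; rewrite !inE => /andP[/s-> /s->].
Qed.

Lemma insideT : inside setT = setT.
Proof. by apply/setP=> e; rewrite !inE. Qed.

Lemma insideI U Z : inside (U :&: Z) = inside U :&: inside Z.
Proof. by apply/setP=> e; rewrite !inE -!andbA; do !bool_congr. Qed.

Lemma inside_supermodular X U Z :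
  #|X :&: inside U| + #|X :&: inside Z| <= #|X :&: inside (U :|: Z)| + #|X :&: inside (U :&: Z)|.
Proof.
rewrite -cardsUI -setIUr setIACA setIid insideI leq_add2r subset_leq_card // setIS //.
by rewrite subUset !insideS ?subsetUl ?subsetUr.
Qed.

Lemma sparse_sub X Y : Y \subset X -> sparse X -> sparse Y.
Proof.
move=> sYX /sparseP sX; apply/sparseP=> U U0; apply: leq_trans (sX U U0).
by rewrite leq_add2r subset_leq_card // setSI.
Qed.

Lemma tightE X U : tight X U -> #|X :&: inside U| + m = m * #|U|.
Proof. by case/andP=> _ /eqP. Qed.

Lemma tight_neq0 X U : tight X U -> U != set0.
Proof. by case/andP. Qed.

Lemma tightS X Y U : Y \subset X -> sparse X -> tight Y U -> tight X U.
Proof.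
move=> sYX /sparseP sX tY; have U0 := tight_neq0 tY; rewrite /tight U0 eqn_leq sX //=.
by rewrite -(tightE tY) leq_add2r subset_leq_card // setSI.
Qed.

Lemma tight_UI X U Z : sparse X -> tight X U -> tight X Z -> U :&: Z != set0 ->
  tight X (U :|: Z) && tight X (U :&: Z).
Proof.
move=> /sparseP sX tU tZ UZ0; rewrite /tight UZ0.
have U0 := tight_neq0 tU.
have UZ : U :|: Z != set0 by rewrite setU_eq0 negb_and U0.
have h1 := sX _ UZ0; have h2 := sX _ UZ; rewrite UZ /=.
have := inside_supermodular X U Z; have := tightE tU; have := tightE tZ.
have : m * #|U :|: Z| + m * #|U :&: Z| = m * #|U| + m * #|Z|.
  by rewrite -!mulnDr cardsUI.
by move: h1 h2; lia.
Qed.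

(** A set that is tight for [Y] is already full, so a larger sparse set has no further edge inside
    it. *)
Lemma tight_inside_sub X Y U : Y \subset X -> sparse X -> tight Y U ->
  X :&: inside U \subset Y.
Proof.
move=> sYX sX tY; have tX := tightS sYX sX tY.
have -> : X :&: inside U = Y :&: inside U; last exact: subsetIl.
apply/esym/eqP; rewrite eqEcard setSI //= -(leq_add2r m) (tightE tX) (tightE tY).
exact: leqnn.
Qed.

(** Tight sets that meet have a tight union, so for sparse [X] this is the largest tight set through
    [x]. Singletons are tight, and these classes partition the vertices. *)
Definition cls X x : {set T} := \bigcup_(U | tight X U && (x \in U)) U.

Lemma sub_cls X U x : tight X U -> x \in U -> U \subset cls X x.
Proof. by move=> tU xU; apply: (bigcup_sup U); rewrite tU. Qed.

(* If [e] cannot be added to [X], its ends lie in a tight set; the smallest one, [U], supports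
   the fundamental circuit of [e]. *)
Lemma sparse_exchange X e : sparse X -> e \notin X ->
  sparse (e |: X) \/
  exists2 U, tight X U & e \in inside U /\
    (forall d, d \in X -> d \in inside U -> sparse (e |: (X :\ d))).
Proof.
move=> sX eX; have [/existsP[U0 /andP[tU0 eU0]]|] :=
  boolP [exists U, tight X U && (e \in inside U)]; last first.
  rewrite negb_exists => /forallP noU; left; apply/sparseP=> U U0.
  have := noU U; rewrite /tight U0 /= negb_and; have := sparseP _ sX U U0.
  rewrite setIUl => le1; case: (boolP (e \in inside U)) => eU.
    rewrite orbF => ne; have -> : [set e] :&: inside U = [set e].
      by apply/setIidPl; rewrite sub1set.
    rewrite cardsU1 inE (negbTE eX) /=; lia.
  move=> _; have -> : [set e] :&: inside U = set0.
    by apply/setP=> z; rewrite !inE; case: eqVneq => // ->; move: eU; rewrite inE => /negbTE.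
  by rewrite set0U.
right; have [U /andP[tU eU] minU] := @arg_minnP _ U0
  (fun U => tight X U && (e \in inside U)) (fun U => #|U|) (introT andP (conj tU0 eU0)).
exists U => //; split=> // d dX dU; apply/sparseP=> Z Z0.
have le1 := sparseP _ sX Z Z0.
have sub1 : (e |: X :\ d) :&: inside Z \subset ([set e] :&: inside Z) :|: (X :&: inside Z) :\ d.
  apply/subsetP=> z; rewrite !(in_setI, in_setU, in_setD1, in_set1).
  by case/andP=> /orP[->|/andP[-> ->]] ->; rewrite ?orbT.
apply: leq_trans (_ : #|([set e] :&: inside Z) :|: (X :&: inside Z) :\ d| + m <= _).
  by rewrite leq_add2r subset_leq_card.
have le2 := leq_of_leqif (leq_card_setU ([set e] :&: inside Z) ((X :&: inside Z) :\ d)).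
apply: leq_trans (_ : #|[set e] :&: inside Z| + #|(X :&: inside Z) :\ d| + m <= _).
  by rewrite leq_add2r.
have sD : #|(X :&: inside Z) :\ d| <= #|X :&: inside Z| by rewrite subset_leq_card ?subsetDl.
case: (boolP (e \in inside Z)) => eZ; last first.
  have -> : [set e] :&: inside Z = set0.
    by apply/setP=> z; rewrite [LHS]inE [RHS]inE in_set1; case: eqVneq => // ->; apply: negbTE.
  by rewrite cards0 add0n; apply: leq_trans le1; rewrite leq_add2r.
have -> : #|[set e] :&: inside Z| = 1.
  by rewrite (setIidPl _) ?cards1 // sub1set.
have [EQ|ne] := eqVneq (#|X :&: inside Z| + m) (m * #|Z|); last first.
  apply: leq_trans (_ : (#|X :&: inside Z| + m).+1 <= _).
    by rewrite -!addnA add1n ltnS leq_add2r.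
  by rewrite ltn_neqAle ne.
(* The only dangerous [Z] are tight and contain [e]. Then [U :&: Z] is tight too, minimality puts
   [U] inside [Z], and the loss of [d] makes room for [e]. *)
have tZ : tight X Z by rewrite /tight Z0 EQ eqxx.
have UZ0 : U :&: Z != set0.
  apply/set0Pn; exists (ends e).1; move: eU eZ; rewrite !inE => /andP[-> _] /andP[-> _] //.
have /andP[_ tUZ] := tight_UI sX tU tZ UZ0.
have := minU (U :&: Z); rewrite tUZ insideI inE eU eZ => /(_ isT) leU.
have sUZ : U \subset Z.
  by apply/setIidPl/eqP; rewrite eqEcard subsetIl leU.
rewrite -EQ leq_add2r [leqRHS](cardsD1 d).
by rewrite inE dX (subsetP (insideS sUZ)).
Qed.

Definition replace X Z Y := (X :\: inside Z) :|: Y.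

Lemma card_replace X Z Y U : tight X Z -> tight Y Z -> Y \subset inside Z ->
  Z \subset U -> #|replace X Z Y :&: inside U| = #|X :&: inside U|.
Proof.
move=> tX tY sY sZU.
have eXY : #|X :&: inside Z| = #|Y|.
  by apply/eqP; rewrite -(eqn_add2r m) (tightE tX) -(tightE tY) (setIidPl sY).
have sZU' := insideS sZU.
rewrite -(cardsID (inside Z) (X :&: inside U)) -(cardsID (inside Z) (replace X Z Y :&: inside U)).
rewrite -!setIA (setIidPr sZU') eXY; congr (_ + _).
  apply: eq_card => z; rewrite in_setI in_setU in_setD.
  case: (boolP (z \in Y)) => [/(subsetP sY) ->|_]; rewrite ?orbT // orbF.
  by rewrite andbAC andNb.
apply: eq_card => z; rewrite !in_setD !in_setI in_setU in_setD.
case: (boolP (z \in inside Z)) => //= zZ.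
by case: (boolP (z \in Y)) => [/(subsetP sY)|]; rewrite ?(negbTE zZ) ?orbF.
Qed.

Lemma card_replace_disjoint X Z Y U : Y \subset inside Z -> [disjoint U & Z] ->
  replace X Z Y :&: inside U = X :&: inside U.
Proof.
move=> sY dUZ; have dI z : z \in inside U -> z \notin inside Z.
  by rewrite !inE => /andP[zU _]; rewrite (disjointFr dUZ zU).
apply/setP=> z; rewrite !in_setI in_setU in_setD.
case: (boolP (z \in inside U)) => [zU|_]; rewrite ?andbF // (dI _ zU).
by case: (boolP (z \in Y)) => [/(subsetP sY)|]; rewrite ?(negbTE (dI _ zU)) ?orbF.
Qed.

(** When [U] meets [Z], edges of [Y] in [U :&: Z] obey the sparsity of [Y]. The other edges of [X]
    in [U] share the bound for [U :|: Z] with the full supply of [X] inside [Z]. Together this is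
    the bound for [U]. *)
Lemma sparse_replace X Z Y : sparse X -> sparse Y -> tight X Z -> tight Y Z -> Y \subset inside Z ->
  sparse (replace X Z Y).
Proof.
move=> sX sY tX tY sYZ; apply/sparseP=> U U0.
have [UZ0|UZ0] := eqVneq (U :&: Z) set0.
  rewrite card_replace_disjoint //; first exact: (sparseP _ sX).
  by rewrite -setI_eq0 UZ0.
have UZ : U :|: Z != set0 by rewrite setU_eq0 negb_and U0.
have h1 := sparseP _ sX _ UZ; have h2 := sparseP _ sY _ UZ0.
have h3 : #|replace X Z Y :&: inside U| <= #|(X :&: inside U) :\: inside Z| + #|Y :&: inside (U :&: Z)|.
  apply: leq_trans (leq_of_leqif (leq_card_setU _ _)); apply/subset_leq_card/subsetP=> z.
  rewrite insideI in_setI [z \in replace _ _ _]in_setU in_setD => /andP[/orP[/andP[h1' h2']|zY] zU].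
    by rewrite in_setU in_setD h1' in_setI h2' zU.
  by rewrite in_setU orbC !in_setI zY zU (subsetP sYZ).
have h4 : #|(X :&: inside U) :\: inside Z| + #|X :&: inside Z| <= #|X :&: inside (U :|: Z)|.
  rewrite -cardsUI [X in _ + X](_ : _ = 0); last first.
    apply/eqP; rewrite cards_eq0 -subset0; apply/subsetP=> z; rewrite !(in_setI, in_setD).
    by case: (z \in inside Z); rewrite ?andbF.
  rewrite addn0 subset_leq_card // subUset; apply/andP; split.
    by apply: subset_trans (subsetDl _ _) _; apply/setIS/insideS/subsetUl.
  by apply/setIS/insideS/subsetUr.
have := tightE tX; have : m * #|U :|: Z| + m * #|U :&: Z| = m * #|U| + m * #|Z|.
  by rewrite -!mulnDr cardsUI.
lia.
Qed.

Hypothesis noloop : forall e, (ends e).1 != (ends e).2.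

Lemma tight1 X x : tight X [set x].
Proof.
rewrite /tight; apply/andP; split; first by apply/set0Pn; exists x; rewrite inE.
rewrite cards1 muln1 (_ : X :&: _ = set0) ?cards0 //.
apply/setP=> e; rewrite !inE; apply/negP=> /and3P[_ /eqP h1 /eqP h2].
by have := noloop e; rewrite h1 h2 eqxx.
Qed.

Lemma mem_cls X x : x \in cls X x.
Proof. by apply: (subsetP (sub_cls (tight1 X x) _)); rewrite inE. Qed.

Lemma tight_cls X x : sparse X -> tight X (cls X x).
Proof.
move=> sX; suff : tight X (cls X x) && (x \in cls X x) by case/andP.
pose P U := tight X U && (x \in U).
have : (cls X x == set0) || P (cls X x).
  apply: (big_ind (fun U => (U == set0) || P U)); first by rewrite eqxx.
    move=> U Z /orP[/eqP->|/andP[tU xU]]; first by rewrite set0U.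
    case/orP=> [/eqP->|/andP[tZ xZ]]; first by rewrite setU0 /P tU xU orbT.
    have UZ : U :&: Z != set0 by apply/set0Pn; exists x; rewrite inE xU.
    have /andP[tUZ _] := tight_UI sX tU tZ UZ.
    by rewrite /P tUZ inE xU !orbT.
  by move=> U; rewrite /P => ->; rewrite orbT.
case/orP=> // /eqP h; by have := mem_cls X x; rewrite h inE.
Qed.

Lemma cls_eq X x y : sparse X -> y \in cls X x -> cls X y = cls X x.
Proof.
move=> sX yx; have sxy := sub_cls (tight_cls x sX) yx.
apply/eqP; rewrite eqEsubset sxy andbT.
exact: sub_cls (tight_cls y sX) (subsetP sxy _ (mem_cls X x)).
Qed.

Lemma cls_sub X Y x : Y \subset X -> sparse X -> cls Y x \subset cls X x.
Proof.
move=> sYX sX; apply: sub_cls (mem_cls Y x).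
exact: tightS (tight_cls x (sparse_sub sYX sX)).
Qed.

Lemma cls_disjoint X x y : sparse X -> y \notin cls X x -> [disjoint cls X x & cls X y].
Proof.
move=> sX yx; rewrite -setI_eq0; apply/negPn/negP=> /set0Pn[z]; rewrite inE => /andP[zx zy].
by move: yx; rewrite -(cls_eq sX zx) (cls_eq sX zy) mem_cls.
Qed.

End Sparse.

(** * Exchanging matching edges *)

Section Exchange.
Variables (T E : finType) (ends : E -> T * T) (m : nat).
Hypothesis noloop : forall e, (ends e).1 != (ends e).2.
Variables (F L : {set E}).
Hypothesis FL : [disjoint F & L].
Implicit Types (X Y N : {set E}) (U Z : {set T}) (e d : E).

Notation sparse := (sparse ends m).
Notation tight := (tight ends m).
Notation cls := (cls ends m).
Notation inside := (inside ends).
Notation replace := (replace ends).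

Definition edge_matching N : bool :=
  (N \subset L) && [forall e in N, forall d in N, forall v,
    incident ends v e ==> incident ends v d ==> (e == d)].

Definition covered N : {set T} := [set v | [exists e in N, incident ends v e]].

Lemma edge_matchingP N :
  reflect (N \subset L /\ forall e d v, e \in N -> d \in N -> incident ends v e ->
             incident ends v d -> e = d)
          (edge_matching N).
Proof.
apply: (iffP andP) => -[NL H]; split=> //.
  move=> e d v eN dN ve vd; move/forall_inP: H => /(_ e eN)/forall_inP/(_ d dN)/forallP/(_ v).
  by rewrite ve vd => /eqP.
apply/forall_inP=> e eN; apply/forall_inP=> d dN; apply/forallP=> v.
by apply/implyP=> ve; apply/implyP=> vd; rewrite (H e d v).
Qed.

Lemma coveredP N v : reflect (exists2 e, e \in N & incident ends v e) (v \in covered N).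
Proof. by rewrite inE; apply: (iffP exists_inP). Qed.

Lemma edge_matching_sub N N' : N' \subset N -> edge_matching N -> edge_matching N'.
Proof.
move=> /subsetP s /edge_matchingP[NL H]; apply/edge_matchingP; split.
  by apply: subset_trans NL; apply/subsetP.
by move=> e d v /s eN /s dN; apply: H.
Qed.

Lemma coveredS N N' : N' \subset N -> covered N' \subset covered N.
Proof.
by move=> /subsetP s; apply/subsetP=> v /coveredP[e /s eN ve]; apply/coveredP; exists e.
Qed.

Lemma incident_inside Z e v : e \in inside Z -> incident ends v e -> v \in Z.
Proof. by rewrite inE => /andP[h1 h2] /orP[] /eqP<-. Qed.

Definition admissible X : bool := sparse X && edge_matching (X :\: F).

Lemma cls_closed X e v : sparse X -> (ends e).2 \in cls X (ends e).1 ->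
  incident ends v e -> e \in inside (cls X v).
Proof.
move=> sX h; have h1 := mem_cls m noloop X (ends e).1.
have hc : v \in cls X (ends e).1 -> e \in inside (cls X v).
  by move=> hv; rewrite (cls_eq noloop sX hv) inE h1 h.
by case/orP=> /eqP ve; apply: hc; rewrite -ve.
Qed.

Variable X : {set E}.
Hypothesis Xadm : admissible X.
Hypothesis Xmax : forall X', admissible X' -> #|X'| <= #|X|.
Hypothesis XmaxF : forall X', admissible X' -> #|X'| = #|X| -> #|X' :&: F| <= #|X :&: F|.

Let sX : sparse X. Proof. by case/andP: Xadm. Qed.
Let mX : edge_matching (X :\: F). Proof. by case/andP: Xadm. Qed.

(* [M'] is the part of the matching [X :\: F] that may still be an obstruction: every vertex that
   it leaves uncovered can be freed by modifying [X] inside a tight class of [X :\: M'] only. *)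
Definition flexible (M' : {set E}) : Prop :=
  [/\ M' \subset X :\: F,
      forall e, e \in (X :\: F) :\: M' -> (ends e).2 \in cls (X :\: M') (ends e).1 &
      forall x, x \notin covered M' -> exists Y,
        [/\ Y \subset inside (cls (X :\: M') x), sparse Y, tight Y (cls (X :\: M') x),
            edge_matching (Y :\: F) &
            forall e v, e \in Y :\: F -> incident ends v e -> v \notin covered M' /\ v <> x]].

(** Once the whole matching is removed, the classes are made tight by edges of [F] alone, so the
    witnesses contain no matching edge. *)
Lemma flexible_matching : flexible (X :\: F).
Proof.
split=> //; first by move=> e; rewrite setDv inE.
move=> x _; rewrite setDDr setDv set0U.
set Z := cls _ _; exists (X :&: F :&: inside Z).
have sXF : sparse (X :&: F) by apply: sparse_sub sX; apply: subsetIl.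
have e0 : (X :&: F :&: inside Z) :\: F = set0.
  by apply/setP=> e; rewrite !in_setD !in_setI in_set0; case: (e \in F); rewrite ?andbF.
split.
- exact: subsetIr.
- by apply: sparse_sub sXF; apply: subsetIl.
- have := tight_cls noloop x sXF; rewrite -/Z => tZ.
  by rewrite /tight (tight_neq0 tZ) -setIA setIid (tightE tZ) /=.
- by rewrite e0; apply/edge_matchingP; split; rewrite ?sub0set // => e d v; rewrite inE.
- by move=> e v; rewrite e0 inE.
Qed.

(** The tight set carrying the fundamental circuit of [e] contains no matching edge: exchanging one
    for [e] would keep the size of [X] and gain an edge of [F]. *)
Lemma span_F e : e \in F -> e \notin X -> (ends e).2 \in cls (X :&: F) (ends e).1.
Proof.
move=> eF eX; have sXF : sparse (X :&: F) by apply: sparse_sub sX; apply: subsetIl.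
have eD N : (e |: N) :\: F = N :\: F.
  by apply/setP=> z; rewrite !in_setD in_setU1; case: eqVneq => // ->; rewrite eF.
case: (sparse_exchange sX eX) => [sXe|[U tU [eU swap]]].
  have /Xmax : admissible (e |: X) by rewrite /admissible sXe eD mX.
  by rewrite cardsU1 eX add1n ltnn.
have noM d : d \in X -> d \in inside U -> d \in F.
  move=> dX dU; apply: contraT => dF.
  have adm : admissible (e |: X :\ d).
    rewrite /admissible swap //= eD; apply: edge_matching_sub mX; apply: setSD.
    exact: subsetDl.
  have := XmaxF adm; rewrite cardsU1 !inE (negbTE eX) andbF /= (cardsD1 d X) dX => /(_ erefl).
  have -> : (e |: X :\ d) :&: F = e |: (X :&: F).
    apply/setP=> z; rewrite !(in_setI, in_setU1, in_setD1).
    case: (eqVneq z e) => [->|_] //=; case: (eqVneq z d) => [->|_] //=.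
    by rewrite (negbTE dF) andbF.
  by rewrite cardsU1 in_setI (negbTE eX) /= ltnn.
have tUF : tight (X :&: F) U.
  rewrite /tight (tight_neq0 tU) /= -(tightE tU) eqn_add2r; apply/eqP/eq_card=> z.
  rewrite !in_setI; case: (boolP (z \in X)) => //= zX.
  by case: (boolP (z \in inside U)) => [/(noM _ zX) ->|]; rewrite ?andbF.
move: eU; rewrite inE => /andP[h1 h2].
exact: (subsetP (sub_cls tUF h1)).
Qed.

(** The witnesses at the two ends of [e0] free both ends, so [e0] could join the matching. By
    maximality the modified set then has a tight set [U0] around [e0]. The edges of [M'] inside [U0]
    can be exchanged for [e0] and are released from [M']. *)
Lemma flexible_step M' e0 : flexible M' -> e0 \in L -> 
  (forall v, incident ends v e0 -> v \notin covered M') ->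
  (ends e0).2 \notin cls (X :\: M') (ends e0).1 ->
  exists2 M'' : {set E}, M'' \proper M' & flexible M''.
Proof.
move=> [M'X hI hII] e0L e0M; set x := (ends e0).1; set y := (ends e0).2.
set Xo := X :\: M' => yx.
have sXo : sparse Xo by apply: sparse_sub sX; apply: subsetDl.
have xe0 : incident ends x e0 by rewrite /incident eqxx.
have ye0 : incident ends y e0 by rewrite /incident eqxx orbT.
have xM := e0M _ xe0; have yM := e0M _ ye0.
set Z := cls Xo x; set Z' := cls Xo y.
have dZ : [disjoint Z & Z'] by apply: cls_disjoint.
have dZ' : [disjoint Z' & Z] by rewrite disjoint_sym.
have [Yx [Yxi sYx tYx mYx aYx]] := hII _ xM; rewrite -/Z in Yxi tYx.
have [Yy [Yyi sYy tYy mYy aYy]] := hII _ yM; rewrite -/Z' in Yyi tYy.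
have xZ : x \in Z by apply: mem_cls.
have yZ' : y \in Z' by apply: mem_cls.
have tZo : tight Xo Z by apply: tight_cls.
have tZ'o : tight Xo Z' by apply: tight_cls.
(* The two modifications take place in disjoint classes and do not interfere. They are also applied
   to the smaller set [Xn] below, hence the parameter [W]. *)
pose rep W := replace (replace W Z Yx) Z' Yy.
have repP W : sparse W -> Xo \subset W -> [/\ sparse (rep W), tight (rep W) Z, tight (rep W) Z' &
   forall U, Z \subset U -> Z' \subset U -> #|rep W :&: inside U| = #|W :&: inside U|].
  move=> sW XoW; have tZ := tightS XoW sW tZo; have tZ' := tightS XoW sW tZ'o.
  have s1 := sparse_replace sW sYx tZ tYx Yxi.
  have t1 : tight (replace W Z Yx) Z'.
    by rewrite /tight (tight_neq0 tZ') card_replace_disjoint // (tightE tZ') /=.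
  have t2 : tight (replace W Z Yx) Z.
    by rewrite /tight (tight_neq0 tZ) (card_replace tZ tYx Yxi (subxx _)) (tightE tZ) /=.
  split.
  - exact: sparse_replace.
  - by rewrite /tight (tight_neq0 tZ) card_replace_disjoint // (tightE t2) /=.
  - by rewrite /tight (tight_neq0 tZ') (card_replace t1 tYy Yyi (subxx _)) (tightE t1) /=.
  - by move=> U ZU Z'U; rewrite (card_replace t1 tYy Yyi Z'U) (card_replace tZ tYx Yxi ZU).
have outM U : tight Xo U -> forall d, d \in M' -> d \notin inside U.
  move=> tU d dM; apply/negP=> dU.
  have dX : d \in X by move/(subsetP M'X): (dM); rewrite inE => /andP[].
  have := subsetP (tight_inside_sub (subsetDl X M') sX tU) d.
  by rewrite in_setI dX dU => /(_ isT); rewrite in_setD dM.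
have M'F d : d \in M' -> d \notin F by move/(subsetP M'X); rewrite inE => /andP[].
have M'X' d : d \in M' -> d \in X by move/(subsetP M'X); rewrite inE => /andP[].
set X1 := rep X.
have repE W d : (d \in rep W) = [|| [&& d \in W, d \notin inside Z & d \notin inside Z'],
                                  (d \in Yx) && (d \notin inside Z') | d \in Yy].
  rewrite /rep /replace in_setU in_setD in_setU in_setD.
  case: (d \in W); case: (d \in inside Z); case: (d \in inside Z'); case: (d \in Yx); by case: (d \in Yy).
have repD (M2 : {set E}) : M2 \subset M' -> rep X :\: M2 = rep (X :\: M2).
  move=> /subsetP sM2; apply/setP=> d; rewrite in_setD !repE in_setD.
  case: (boolP (d \in M2)) => //= /sM2 dM; apply/esym/negbTE.
  rewrite negb_or negb_and (_ : d \in Yx = false) /=; last first.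
    by apply/negbTE; apply: contra (outM _ tZo _ dM) => /(subsetP Yxi).
  by apply: contra (outM _ tZ'o _ dM) => /(subsetP Yyi).
have M'X1 d : d \in M' -> d \in X1.
  by move=> dM; rewrite repE M'X' // (outM _ tZo) // (outM _ tZ'o).
have [sX1 tX1Z tX1Z' cX1] := repP X sX (subsetDl _ _).
have cardX1 : #|X1| = #|X|.
  by have := cX1 setT (subsetT _) (subsetT _); rewrite insideT !setIT.
have X1cases d : d \in X1 :\: F ->
  [\/ [/\ d \in X :\: F, d \notin inside Z & d \notin inside Z'], d \in Yx :\: F | d \in Yy :\: F].
  rewrite !in_setD repE => /andP[dF /or3P[/and3P[h1 h2 h3]|/andP[h1 _]|h1]].
  - by apply: Or31; rewrite h1 dF.
  - by apply: Or32; rewrite h1 dF.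
  - by apply: Or33; rewrite h1 dF.
(* A matching edge outside [M'] stays within a class, so one that leaves the class of [v] belongs to
   [M']. The witnesses avoid the vertices covered by [M'], hence never collide with such an edge. *)
have old d v : d \in X :\: F -> d \notin inside (cls Xo v) -> incident ends v d ->
   v \in covered M' .
  move=> dXF dn vd; apply/coveredP; exists d => //; apply: contraT => dM.
  have := hI d; rewrite in_setD dM dXF => /(_ isT) hd.
  by rewrite (cls_closed sXo hd vd) in dn.
have clsZ v : v \in Z -> cls Xo v = Z by move=> h; apply: cls_eq.
have clsZ' v : v \in Z' -> cls Xo v = Z' by move=> h; apply: cls_eq.
have mX1 : edge_matching ((e0 |: X1) :\: F).
  have e0F : e0 \notin F by rewrite (disjointFl FL).
  have Xuncov d v : d \in X1 :\: F -> incident ends v d -> v \notin [set x; y].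
    move=> dX1 vd; rewrite !inE negb_or.
    case: (X1cases _ dX1) => [[h1 h2 h3]|h|h].
    - apply/andP; split; apply/eqP=> vE; subst v.
        by rewrite (old d x) // in xM.
      by rewrite (old d y) // in yM.
    - have [_ /eqP-> /=] := aYx _ _ h vd; apply/eqP=> vE; subst v.
      have : y \in Z by apply: incident_inside vd; apply: (subsetP Yxi); move: h; rewrite inE => /andP[].
      by rewrite (negbTE yx).
    - have [_ /eqP ny] := aYy _ _ h vd; rewrite ny andbT; apply/eqP=> vE; subst v.
      have : x \in Z' by apply: incident_inside vd; apply: (subsetP Yyi); move: h; rewrite inE => /andP[].
      by rewrite (disjointFr dZ).
  have endse0 v : incident ends v e0 -> v \in [set x; y].
    by rewrite !inE /incident eq_sym (eq_sym _ v).
  have inZ d v : d \in Yx :\: F -> incident ends v d -> v \in Z.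
    by move=> h; apply: incident_inside; apply: (subsetP Yxi); move: h; rewrite inE => /andP[].
  have inZ' d v : d \in Yy :\: F -> incident ends v d -> v \in Z'.
    by move=> h; apply: incident_inside; apply: (subsetP Yyi); move: h; rewrite inE => /andP[].
  have /edge_matchingP[XL Xm] := mX; have /edge_matchingP[YxL Yxm] := mYx.
  have /edge_matchingP[YyL Yym] := mYy.
  have key d d' v : d \in X1 :\: F -> d' \in X1 :\: F -> incident ends v d -> incident ends v d' -> d = d'.
    move=> dX1 d'X1 vd vd'.
    case: (X1cases _ dX1) => [[h1 h2 h3]|h|h]; case: (X1cases _ d'X1) => [[h1' h2' h3']|h'|h'].
    - exact: Xm vd vd'.
    - have [/negP[]] := aYx _ _ h' vd'; apply: old vd => //.
      by rewrite clsZ // (inZ _ _ h').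
    - have [/negP[]] := aYy _ _ h' vd'; apply: old vd => //.
      by rewrite clsZ' // (inZ' _ _ h').
    - have [/negP[]] := aYx _ _ h vd; apply: old vd' => //.
      by rewrite clsZ // (inZ _ _ h).
    - exact: Yxm vd vd'.
    - by have := inZ _ _ h vd; rewrite (disjointFl dZ) // (inZ' _ _ h').
    - have [/negP[]] := aYy _ _ h vd; apply: old vd' => //.
      by rewrite clsZ' // (inZ' _ _ h).
    - by have := inZ _ _ h' vd'; rewrite (disjointFl dZ) // (inZ' _ _ h).
    - exact: Yym vd vd'.
  apply/edge_matchingP; split.
    apply/subsetP=> d; rewrite in_setD in_setU1 => /andP[dF /orP[/eqP->|dX1]] //.
    have : d \in X1 :\: F by rewrite in_setD dF.
    case/X1cases=> [[h _ _]|h|h]; first exact: (subsetP XL).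
      exact: (subsetP YxL).
    exact: (subsetP YyL).
  move=> d d' v; rewrite ![_ \in _ :\: F]in_setD !in_setU1.
  case/andP=> dF /orP[/eqP->|dX1] /andP[d'F /orP[/eqP->|d'X1]] vd vd' //.
  - by have := Xuncov d' v; rewrite in_setD d'F d'X1 endse0 // => /(_ isT vd').
  - by have := Xuncov d v; rewrite in_setD dF dX1 endse0 // => /(_ isT vd).
  - by apply: key vd vd'; rewrite in_setD ?dF ?d'F.
have e0X1 : e0 \notin X1.
  have e0F : e0 \notin F by rewrite (disjointFl FL).
  apply/negP=> h; have : e0 \in X1 :\: F by rewrite in_setD e0F.
  case/X1cases=> [[h1 h2 _]|h1|h1].
  - by have := old _ _ h1 h2 xe0; rewrite (negbTE xM).
  - by have [_] := aYx _ _ h1 xe0.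
  - by have [_] := aYy _ _ h1 ye0.
case: (sparse_exchange sX1 e0X1) => [sX1e|[U0 tU0 [e0U0 swap]]].
  have : #|e0 |: X1| <= #|X| by apply: Xmax; rewrite /admissible sX1e.
  by rewrite cardsU1 e0X1 cardX1 add1n ltnn.
have [xU0 yU0] : x \in U0 /\ y \in U0 by move: e0U0; rewrite inE => /andP.
pose M'' := M' :\: inside U0.
have M''s : M'' \subset M' by apply: subsetDl.
pose Xn := X :\: M''.
have sXn : sparse Xn by apply: sparse_sub sX; apply: subsetDl.
have XoXn : Xo \subset Xn by apply: setDS.
have [sX1n tX1nZ tX1nZ' cX1n] := repP Xn sXn XoXn.
have X1nE : rep Xn = X1 :\: M'' by rewrite -repD.
have tU0n : tight (rep Xn) U0.
  rewrite X1nE /tight (tight_neq0 tU0) /= -(tightE tU0) eqn_add2r; apply/eqP/eq_card=> d.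
  rewrite !in_setI !in_setD; case: (d \in inside U0); rewrite ?andbF //=.
(* In [rep Xn] these tight sets meet in [x] and in [y], so their union is tight. As it contains both
   modified classes, it is tight for the unmodified [Xn] as well. *)
pose U := U0 :|: Z :|: Z'.
have tUn : tight (rep Xn) U.
  have /andP[t1 _] : tight (rep Xn) (U0 :|: Z) && tight (rep Xn) (U0 :&: Z).
    by apply: tight_UI => //; apply/set0Pn; exists x; rewrite inE xU0.
  have /andP[-> //] : tight (rep Xn) U && tight (rep Xn) ((U0 :|: Z) :&: Z').
  by apply: tight_UI => //; apply/set0Pn; exists y; rewrite !inE yU0.
have [U0U ZU Z'U] : [/\ U0 \subset U, Z \subset U & Z' \subset U].
  by rewrite /U; split; apply/subsetP=> v vU; rewrite !in_setU vU ?orbT.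
have tUXn : tight Xn U.
  by rewrite /tight (tight_neq0 tUn) -cX1n // (tightE tUn) /=.
(* If nothing were released, [U] would be a tight set of [Xo] containing [x] and [y], which lie in
   different classes. *)
have M''p : M'' \proper M'.
  rewrite properEneq M''s andbT; apply/eqP=> EM.
  have tUo : tight Xo U by rewrite /Xo -EM.
  by move: yx; rewrite (subsetP (sub_cls tUo _)) ?(subsetP U0U).
exists M'' => //.
have covM'' : covered M'' \subset covered M' by apply: coveredS.
have hI' d : d \in (X :\: F) :\: M'' -> (ends d).2 \in cls Xn (ends d).1.
  rewrite in_setD => /andP[dM'' dXF]; case: (boolP (d \in M')) => dM.
    have : d \in inside U by apply: (subsetP (insideS _ U0U)); move: dM''; rewrite in_setD dM andbT negbK.
    rewrite inE => /andP[h1 h2]; exact: (subsetP (sub_cls tUXn h1)).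
  apply: (subsetP (cls_sub noloop _ XoXn sXn)); apply: hI.
  by rewrite in_setD dM.
split=> //; first exact: subset_trans M''s M'X.
move=> x' x'M''; set W := cls Xn x'.
have tW : tight Xn W by apply: tight_cls.
have /edge_matchingP[XL Xm] := mX.
case: (boolP (x' \in covered M')) => x'M.
  have {x'M}[d dM x'd] := coveredP _ _ x'M.
  have dU0 : d \in inside U0.
    apply: contraT => nd; case/negP: x'M''; apply/coveredP; exists d => //.
    by rewrite in_setD nd.
  have x'U0 : x' \in U0 by apply: incident_inside x'd.
  have UW : U \subset W by apply: sub_cls tUXn (subsetP U0U _ x'U0).
  have dX1 := M'X1 _ dM.
  have dM'' : d \notin M'' by rewrite in_setD dU0.
  have e0M'' : e0 \notin M'' by apply: contra e0X1 => /(subsetP M''s)/M'X1.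
  (* The edge [d] of [M'] that covers [x'] lies inside [U0], so trading it for [e0] preserves
     sparsity and frees [x']. *)
  pose V := e0 |: (X1 :\ d).
  exists ((V :\: M'') :&: inside W).
  have sV : sparse V by apply: swap.
  have VF : ((V :\: M'') :&: inside W) :\: F \subset ((e0 |: X1) :\: F).
    apply: setSD; apply: subset_trans (subsetIl _ _) _; apply: subset_trans (subsetDl _ _) _.
    by apply: setUS; apply: subsetDl.
  have /edge_matchingP[_ m1] := mX1.
  have dF := M'F _ dM.
  split.
  - exact: subsetIr.
  - by apply: sparse_sub sV; apply: subset_trans (subsetIl _ _) (subsetDl _ _).
  - have ZW := subset_trans ZU UW; have Z'W := subset_trans Z'U UW.
    rewrite /tight (tight_neq0 tW) /= -setIA setIid -(tightE tW) -cX1n // X1nE eqn_add2r.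
    have gen (A1 W1 : {set E}) : e0 \notin A1 -> e0 \in W1 ->
      (V :\: A1) :&: W1 = e0 |: (((X1 :\: A1) :&: W1) :\ d).
      move=> eA eW; apply/setP=> z; rewrite !(in_setI, in_setD, in_setU1, in_set1).
      case: (eqVneq z e0) => [->|_] /=; first by rewrite eA eW.
      by case: (z == d); rewrite ?andbF ?andbT.
    rewrite gen //; last exact: (subsetP (insideS _ (subset_trans U0U UW))).
    have din : d \in (X1 :\: M'') :&: inside W.
      by rewrite in_setI in_setD dM'' dX1 (subsetP (insideS _ (subset_trans U0U UW)) _ dU0).
    have e0nin : e0 \notin ((X1 :\: M'') :&: inside W) :\ d.
      by apply: contra e0X1; rewrite in_setD1 in_setI in_setD => /andP[_ /andP[/andP[]]].
    by apply/eqP; rewrite cardsU1 e0nin [RHS](cardsD1 d) din.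
  - exact: edge_matching_sub VF mX1.
  - move=> z v zV vz; have z1 := subsetP VF _ zV.
    have zE : z \in V :\: M'' by move: zV; rewrite in_setD in_setI => /and3P[].
    move: zE; rewrite in_setD => /andP[zM'' zV'].
    split.
      apply/negP=> /coveredP[d2 d2M'' vd2].
      have d2M := subsetP M''s _ d2M''.
      have E2 : z = d2.
        by apply: m1 z1 _ vz vd2; rewrite in_setD in_setU1 M'F // M'X1 // orbT.
      by rewrite E2 d2M'' in zM''.
    move=> E2; subst v.
    have E3 : z = d.
      by apply: m1 z1 _ vz x'd; rewrite in_setD in_setU1 dF dX1 orbT.
    move: zV'; rewrite E3 in_setU1 in_setD1 eqxx orbF => /eqP E4.
    by rewrite -E4 dX1 in e0X1.
(* Otherwise the old witness is kept on the old class [Z1] of [x'] and completed by the edges of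
   [Xn] in the rest of the larger class [W]. *)
have [Y1 [Y1i sY1 tY1 mY1 aY1]] := hII _ x'M.
set Z1 := cls Xo x' in Y1i tY1.
have Z1W : Z1 \subset W by apply: cls_sub.
have tZ1 : tight Xo Z1 by apply: tight_cls.
pose Xw := Xn :&: inside W.
have sXw : sparse Xw by apply: sparse_sub sXn; apply: subsetIl.
have tWw : tight Xw W by rewrite /tight (tight_neq0 tW) /Xw -setIA setIid (tightE tW) /=.
have tZ1w : tight Xw Z1.
  have := tightS XoXn sXn tZ1 => t1; rewrite /tight (tight_neq0 t1) /Xw -setIA.
  by rewrite (setIidPr (insideS _ Z1W)) (tightE t1) /=.
exists (replace Xw Z1 Y1).
have Ycases z : z \in replace Xw Z1 Y1 :\: F ->
  [/\ z \in X :\: F, z \notin M'' & z \notin inside Z1] \/ z \in Y1 :\: F.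
  case/setDP=> /setUP[/setDP[/setIP[/setDP[h1 h2] h3] h4]|h1] zF.
    by left; split=> //; rewrite in_setD zF.
  by right; rewrite in_setD zF.
have new z v : z \in X :\: F -> z \notin inside Z1 -> v \in Z1 -> incident ends v z -> v \in covered M'.
  by move=> h1 h2 h3; apply: old => //; rewrite (cls_eq noloop sXo h3).
have inZ1 z v : z \in Y1 :\: F -> incident ends v z -> v \in Z1.
  by move=> h; apply: incident_inside; apply: (subsetP Y1i); move: h; rewrite inE => /andP[].
have /edge_matchingP[Y1L Y1m] := mY1.
split.
- rewrite subUset; apply/andP; split; last exact: subset_trans Y1i (insideS _ Z1W).
  by apply: subset_trans (subsetDl _ _) (subsetIr _ _).
- exact: sparse_replace.
- by rewrite /tight (tight_neq0 tW) (card_replace tZ1w tY1 Y1i Z1W) (tightE tWw) /=.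
- apply/edge_matchingP; split.
    apply/subsetP=> z /Ycases[[h _ _]|h]; first exact: (subsetP XL).
    exact: (subsetP Y1L).
  move=> z z' v /Ycases[[h1 h2 h3]|h] /Ycases[[h1' h2' h3']|h'] vz vz'.
  + exact: Xm vz vz'.
  + by have [/negP[]] := aY1 _ _ h' vz'; apply: new vz => //; apply: inZ1 h' vz'.
  + by have [/negP[]] := aY1 _ _ h vz; apply: new vz' => //; apply: inZ1 h vz.
  + exact: Y1m vz vz'.
- move=> z v /Ycases[[h1 h2 h3]|h] vz; last first.
    by have [h1 h2] := aY1 _ _ h vz; split=> //; apply: contra h1; apply: (subsetP covM'').
  split.
    apply/negP=> /coveredP[d2 d2M'' vd2].
    have E2 : z = d2.
      apply: Xm vz vd2 => //; apply: (subsetP M'X); exact: (subsetP M''s).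
    by rewrite E2 d2M'' in h2.
  move=> E2; subst v; case/negP: x'M; apply: new vz => //.
  exact: mem_cls.
Qed.

Theorem flexible_minimal : exists2 M', flexible M' &
  forall e, e \in L -> (forall v, incident ends v e -> v \notin covered M') ->
  (ends e).2 \in cls (X :\: M') (ends e).1.
Proof.
suff H n (M' : {set E}) : #|M'| < n -> flexible M' -> exists2 M', flexible M' &
  forall e, e \in L -> (forall v, incident ends v e -> v \notin covered M') ->
  (ends e).2 \in cls (X :\: M') (ends e).1.
  exact: H (ltnSn _) flexible_matching.
elim: n M' => // n IH M' le_n fM.
pose bad e := [&& e \in L, [forall v, incident ends v e ==> (v \notin covered M')] &
                  (ends e).2 \notin cls (X :\: M') (ends e).1].
have [/existsP[e /and3P[eL /forallP eM ecls]]|] := boolP [exists e, bad e].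
  have eM' v : incident ends v e -> v \notin covered M' by apply/implyP.
  have [M'' /proper_card lt fM''] := flexible_step fM eL eM' ecls.
  by apply: (IH M'') => //; lia.
rewrite negb_exists => /forallP nb; exists M' => // e eL eM; have := nb e.
rewrite /bad eL /= negb_and negbK => /orP[|//]; case/negP; apply/forallP=> v.
by apply/implyP; apply: eM.
Qed.

End Exchange.

(** * Packing spanning trees *)

Section Arborescences.
Variables (T E : finType) (ends : E -> T * T) (hd tl : E -> T) (r : T).
Hypothesis joins_arc : forall e, joins ends e (tl e) (hd e).
Implicit Types (A D : {set E}) (S W : {set T}) (a e : E).

Definition entering D W : {set E} := [set e in D | (hd e \in W) && (tl e \notin W)].

Lemma entering_submodular D W W' :
  #|entering D (W :&: W')| + #|entering D (W :|: W')| <= #|entering D W| + #|entering D W'|.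
Proof.
rewrite -!sum1_card ![in leqLHS](big_mkcond (fun e => e \in _)) ![in leqRHS](big_mkcond (fun e => e \in _)) /=.
rewrite -!big_split /=; apply: leq_sum => e _; rewrite !inE.
by case: (e \in D); case: (hd e \in W); case: (tl e \in W); case: (hd e \in W'); case: (tl e \in W').
Qed.

Definition rooted_cut k D := forall W, W != set0 -> r \notin W -> k <= #|entering D W|.

(* Lovasz's argument for Edmonds' branching theorem: the arborescence [A] on [S] is grown inside
   a minimal critical set [W]. *)
Lemma arborescence_grow k D A S :
  rooted_cut k.+1 D -> r \in S -> S != setT -> A \subset D ->
  (forall e, e \in A -> hd e \in S) -> rooted_cut k (D :\: A) ->
  exists2 a, a \in D :\: A & [/\ tl a \in S, hd a \notin S & rooted_cut k (D :\: (a |: A))].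
Proof.
move=> cD rS ST AD AS cA.
have cS W : W != set0 -> [disjoint W & S] -> k < #|entering (D :\: A) W|.
  move=> W0 dWS; have rW : r \notin W by rewrite (disjointFl dWS).
  apply: leq_trans (cD _ W0 rW) _; apply/subset_leq_card/subsetP=> e.
  rewrite !inE => /andP[-> /andP[hW ->]]; rewrite hW !andbT.
  by apply/negP=> /AS; rewrite (disjointFr dWS).
pose critical W := [&& r \notin W, ~~ (W \subset S) & #|entering (D :\: A) W| == k].
pose crosses a W := (hd a \in W) && (tl a \notin W).
have cut_add a : hd a \notin S -> (forall W, critical W -> ~~ crosses a W) ->
    rooted_cut k (D :\: (a |: A)).
  move=> haS nc W W0 rW; have := cA _ W0 rW.
  have eE : entering (D :\: (a |: A)) W = entering (D :\: A) W :\ a.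
    by apply/setP=> e; rewrite !inE negb_or; case: eqVneq.
  rewrite eE leq_eqVlt (cardsD1 a (entering (D :\: A) W)) => /orP[/eqP Ek|].
    case: (boolP (a \in entering (D :\: A) W)) Ek => [aW|_] Ek; last by rewrite Ek add0n.
    have /nc : critical W.
      rewrite /critical rW (cardsD1 a) aW -Ek eqxx andbT; apply/negP=> /subsetP/(_ (hd a)).
      by move: aW; rewrite inE (negbTE haS) => /and3P[_ -> _] /(_ isT).
    by move: aW; rewrite inE /crosses => /and3P[_ -> ->].
  by case: (a \in _); rewrite ?add1n ?add0n // => /ltnW.
have [/existsP[W0 cW0]|] := boolP [exists W, critical W]; last first.
  rewrite negb_exists => /forallP nc.
  have /card_gt0P[a] : 0 < #|entering (D :\: A) (~: S)|.
    apply: leq_ltn_trans (cS _ _ _) => //; first by rewrite -setCT (inj_eq (can_inj (@setCK _))).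
    by rewrite disjoint_sym disjoints_subset setCK.
  rewrite inE => /and3P[aDA haS taS]; rewrite !inE negbK in haS taS.
  by exists a => //; split=> //; apply: cut_add => // W; rewrite (negbTE (nc W)).
have [W cW minW] := @arg_minnP _ W0 critical (fun W => #|W|) cW0.
have /and3P[rW WS /eqP Wk] := cW.
have WS0 : W :\: S != set0 by rewrite setD_eq0.
have lt : #|entering (D :\: A) W| < #|entering (D :\: A) (W :\: S)|.
  rewrite Wk; apply: cS => //.
  by rewrite disjoint_sym disjoints_subset setCD; apply: subsetUr.
have [a aWS aW] : exists2 a, a \in entering (D :\: A) (W :\: S) & a \notin entering (D :\: A) W.
  have : ~~ (entering (D :\: A) (W :\: S) \subset entering (D :\: A) W).
    by apply/negP=> /subset_leq_card; rewrite leqNgt lt.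
  by move/subsetPn.
move: aWS aW; rewrite ![a \in entering _ _]inE => /and3P[aDA]; rewrite aDA /= !in_setD.
case/andP=> haS haW; rewrite haW /= negb_and !negbK => taSW taW; rewrite taW orbF in taSW.
(* If [a] entered another critical set [W'], submodularity would make [W :&: W'] critical; it lacks
   the tail of [a], against the minimality of [W]. *)
exists a => //; split=> //; apply: cut_add => // W' cW'; apply/negP=> /andP[haW' taW'].
have /and3P[rW' _ /eqP W'k] := cW'.
have I0 : W :&: W' != set0 by apply/set0Pn; exists (hd a); rewrite inE haW.
have U0 : W :|: W' != set0 by apply/set0Pn; exists (hd a); rewrite inE haW.
have h1 := cA _ I0; have h2 := cA _ U0; have := entering_submodular (D :\: A) W W'.
rewrite !inE ?negb_or ?negb_and ?rW ?rW' in h1 h2; have {}h1 := h1 isT; have {}h2 := h2 isT.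
rewrite Wk W'k => h3.
have cI : critical (W :&: W').
  rewrite /critical inE (negbTE rW) /= eqn_leq h1 andbT; apply/andP; split.
    by apply/subsetPn; exists (hd a); rewrite ?inE ?haW.
  rewrite -(leq_add2r #|entering (D :\: A) (W :|: W')|); apply: leq_trans h3 _.
  by rewrite leq_add2l.
have := minW _ cI; rewrite leqNgt => /negP; apply; apply: proper_card.
by apply/properP; split; [apply: subsetIl | exists (tl a); rewrite // inE (negbTE taW') andbF].
Qed.

Lemma arborescence_exists k D : rooted_cut k.+1 D ->
  exists A : {set E}, [/\ A \subset D, #|A|.+1 = #|T|,
    forall x, connect (adjE ends A) r x & rooted_cut k (D :\: A)].
Proof.
move=> cD.
suff H n A S : #|~: S| < n -> r \in S -> A \subset D -> (forall e, e \in A -> hd e \in S) ->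
    #|A|.+1 = #|S| -> (forall x, x \in S -> connect (adjE ends A) r x) -> rooted_cut k (D :\: A) ->
  exists A : {set E}, [/\ A \subset D, #|A|.+1 = #|T|,
    forall x, connect (adjE ends A) r x & rooted_cut k (D :\: A)].
  apply: (H _ set0 [set r] (ltnSn _)); rewrite ?sub0set ?set11 ?cards0 ?cards1 //.
  - by move=> e; rewrite in_set0.
  - by move=> x /set1P->; rewrite connect0.
  - by rewrite setD0 => W W0 rW; apply: leq_trans (leqnSn k) (cD _ W0 rW).
elim: n A S => // n IH A S le_n rS AD AS cardA conA cA.
have [ST|ST] := eqVneq S setT.
  by exists A; split=> // [|x]; [rewrite cardA ST cardsT | apply: conA; rewrite ST inE].
have [a aDA [taS haS ca]] := arborescence_grow cD rS ST AD AS cA.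
move: aDA; rewrite in_setD => /andP[aA aD].
have sA : subrel (connect (adjE ends A)) (connect (adjE ends (a |: A))).
  apply: connect_sub => x y /existsP[e /andP[eA exy]]; apply: connect1.
  by apply/existsP; exists e; rewrite in_setU1 eA orbT.
apply: (IH (a |: A) (hd a |: S)) => //.
- apply: (@leq_trans #|~: S|) le_n; rewrite setCU; apply: proper_card; apply/properP; split.
    exact: subsetIr.
  by exists (hd a); rewrite !inE ?haS // eqxx.
- by rewrite in_setU1 rS orbT.
- by rewrite subUset sub1set aD.
- by move=> e /setU1P[->|/AS h]; rewrite in_setU1 ?eqxx // h orbT.
- by rewrite !cardsU1 aA haS !add1n cardA.
- move=> x /setU1P[->|/conA/sA //]; apply: connect_trans (sA _ _ (conA _ taS)) (connect1 _).
  by apply/existsP; exists a; rewrite in_setU1 eqxx joins_arc.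
Qed.

Lemma arborescence_packing m D : rooted_cut m D ->
  exists Ts : nat -> {set E}, (forall i, i < m -> [/\ Ts i \subset D, #|Ts i|.+1 = #|T| &
     forall x, connect (adjE ends (Ts i)) r x]) /\
   (forall i j, i < m -> j < m -> i != j -> [disjoint Ts i & Ts j]).
Proof.
elim: m D => [|m IH] D cD; first by exists (fun _ => set0).
have [A [AD cA conA cDA]] := arborescence_exists cD.
have [Ts [H1 H2]] := IH _ cDA.
exists (fun i => if i == m then A else Ts i); split=> [i|i j].
  rewrite ltnS leq_eqVlt; case: eqVneq => [_ _|_ /= /H1[h1 h2 h3]] //.
  by split=> //; apply: subset_trans h1 (subsetDl _ _).
rewrite !ltnS [i <= m]leq_eqVlt [j <= m]leq_eqVlt; case: (eqVneq i m) => [->|im]; case: (eqVneq j m) => [->|jm] //=.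
- move=> _ /H1[h1 _ _] _; rewrite disjoint_sym; apply: disjointWl h1 _.
  by rewrite disjoints_subset setDE subsetIr.
- move=> /H1[h1 _ _] _ _; apply: disjointWl h1 _.
  by rewrite disjoints_subset setDE subsetIr.
- exact: H2.
Qed.

End Arborescences.

(** * Orientations with prescribed indegrees *)

Section Orientation.
Variables (T E : finType) (ends : E -> T * T) (m : nat) (X : {set E}) (r : T).
Implicit Types (o : {ffun E -> bool}).

Definition ohead o e := if o e then (ends e).2 else (ends e).1.
Definition otail o e := if o e then (ends e).1 else (ends e).2.
Definition indeg o v := #|[set e in X | ohead o e == v]|.
Definition target v := if v == r then 0 else m.
Definition arc o : rel T := fun x y => [exists e in X, (otail o e == x) && (ohead o e == y)].
Definition deficit o := \sum_v (target v - indeg o v).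
Definition flip o e : {ffun E -> bool} := [ffun d => o d (+) (d == e)].

Lemma indeg_flip o e v : e \in X -> otail o e != ohead o e ->
  indeg (flip o e) v + (v == ohead o e) = indeg o v + (v == otail o e).
Proof.
move=> eX nl; rewrite /indeg (cardsD1 e) (cardsD1 e [set e0 in X | ohead o e0 == v]).
rewrite !inE eX /= /ohead /otail /flip ffunE eqxx addbT.
have -> : #|[set e0 in X | (if [ffun d => o d (+) (d == e)] e0 then (ends e0).2 else (ends e0).1) == v] :\ e| =
  #|[set e0 in X | (if o e0 then (ends e0).2 else (ends e0).1) == v] :\ e|.
  apply: eq_card => d; rewrite !inE ffunE; case: eqVneq => //= nde.
  by rewrite addbF.
by rewrite !(eq_sym v); case: (o e) => /=; lia.
Qed.

(** Reversing the first arc moves one unit of indegree from [x] to [u]. Either [x] had a surplus and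
    the deficit drops, or [x] becomes deficient in place of [u] and the rest of the path is used. *)
Lemma flip_path o u p :
  path (arc o) u p -> uniq (u :: p) -> indeg o u < target u ->
  target (last u p) < indeg o (last u p) -> exists o', deficit o' < deficit o.
Proof.
elim: p o u => [|x p IH] o u /=; first by move=> _ _ h1 h2; have := ltn_trans h1 h2; rewrite ltnn.
case/andP=> /existsP[e /and3P[eX /eqP te /eqP he]] pp /andP[]; rewrite in_cons negb_or.
case/andP=> nux nup /andP[xp up] lu tl.
have nl : otail o e != ohead o e by rewrite te he.
have iE v : indeg (flip o e) v + (v == x) = indeg o v + (v == u).
  by have := indeg_flip v eX nl; rewrite te he.
have others : \sum_(v | (v != u) && (v != x)) (target v - indeg (flip o e) v) =
              \sum_(v | (v != u) && (v != x)) (target v - indeg o v).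
  apply: eq_bigr => v /andP[/negbTE vu /negbTE vx].
  by have := iE v; rewrite vu vx !addn0 => ->.
have defE o1 : deficit o1 = (target u - indeg o1 u) + ((target x - indeg o1 x) +
    \sum_(v | (v != u) && (v != x)) (target v - indeg o1 v)).
  by rewrite /deficit (bigD1 u) //= (bigD1 x) ?(eq_sym x) //.
have iu := iE u; rewrite eqxx (negbTE nux) addn0 addn1 in iu.
have ix := iE x; rewrite eqxx (eq_sym x) (negbTE nux) addn0 addn1 in ix.
case: (ltnP (target x) (indeg o x)) => hx.
  exists (flip o e); rewrite !defE others iu; move: ix lu hx; clear; lia.
have dE : deficit (flip o e) = deficit o by rewrite !defE others iu; move: ix lu hx; clear; lia.
have arcS : {in predC1 u &, subrel (arc o) (arc (flip o e))}.
  move=> y z /= yu _ /existsP[d /and3P[dX /eqP td /eqP hd]].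
  have nde : d != e by apply: contraNneq yu => dE'; rewrite -td dE' te.
  apply/existsP; exists d; rewrite dX /otail /ohead /flip ffunE (negbTE nde) addbF.
  by rewrite -[X in X == y]/(otail o d) td -[X in X == z]/(ohead o d) hd !eqxx.
have nup' : all (predC1 u) (x :: p).
  by apply/allP=> y yp /=; apply: contraTneq yp => ->; rewrite in_cons negb_or nux.
have pp' := sub_in_path arcS nup' pp.
rewrite -dE; apply: (IH _ x) => //=; rewrite ?xp //; first by move: ix hx; clear; lia.
have iv := iE (last x p).
have lp : last x p != u by have := allP nup' _ (mem_last x p).
rewrite (negbTE lp) addn0 in iv; move: iv; case: eqVneq => [lx|_] /=.
  by move: tl hx; rewrite lx; clear; lia.
by rewrite addn0 => ->.
Qed.


Lemma joins_otail o e : joins ends e (otail o e) (ohead o e).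
Proof.
by rewrite /joins /otail /ohead; case: (o e); rewrite -surjective_pairing eqxx ?orbT.
Qed.

Lemma sum_indeg o (W : {set T}) : (forall e, e \in X -> ohead o e \in W -> otail o e \in W) ->
  \sum_(v in W) indeg o v = #|X :&: inside ends W|.
Proof.
move=> cl; have -> : X :&: inside ends W = [set e in X | ohead o e \in W].
  apply/setP=> e; rewrite !inE; case: (boolP (e \in X)) => //= eX.
  have := cl e eX; rewrite /ohead /otail.
  by case: (o e); case: (_ \in W); case: (_ \in W) => //= /(_ isT).
rewrite -sum1_card (partition_big (ohead o) (mem W)) /=; last first.
  by move=> e; rewrite inE => /andP[].
apply: eq_bigr => v vW; rewrite /indeg -sum1_card; apply: eq_bigl => e.
by rewrite !inE; case: (e \in X) => //=; case: eqVneq => [->|]; rewrite ?vW ?andbF.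
Qed.

(** At minimum deficit, no vertex of the set [W] reachable from a deficient [u] has a surplus, so
    [W] receives less than its target. An edge with head outside [W] lies entirely outside, where
    sparsity bounds the indegrees. The total falls short of [#|X|]. *)
Lemma orientation_exists : sparse ends m X -> tight ends m X setT ->
  exists o, forall v, target v <= indeg o v.
Proof.
move=> /sparseP sX tX; have [o _ omin] := @arg_minnP _ [ffun=> true] predT deficit isT.
exists o => u; rewrite leqNgt; apply/negP=> lu.
pose W := [set v | connect (arc o) u v].
have uW : u \in W by rewrite inE connect0.
have over : exists2 v, v \in W & target v < indeg o v.
  apply/exists_inP; apply: contraT; rewrite negb_exists_in => /forall_inP noover.
  have lt1 : \sum_(v in W) indeg o v < \sum_(v in W) target v.
    rewrite (bigD1 u) //= [X in _ < X](bigD1 u) //= -addSn; apply: leq_add => //.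
    by apply: leq_sum => v /andP[/noover]; rewrite -leqNgt.
  have le1 : \sum_(v in W) target v + m * (r \in W) <= m * #|W|.
    rewrite [leqRHS]mulnC -sum_nat_const; case: (boolP (r \in W)) => rW; last first.
      by rewrite muln0 addn0; apply: leq_sum => v _; rewrite /target; case: ifP.
    rewrite muln1 (bigD1 r) //= [leqRHS](bigD1 r) //= /target eqxx add0n addnC leq_add2l.
    by apply: leq_sum => v _; case: ifP.
  have tot : \sum_(v in W) indeg o v + \sum_(v in ~: W) indeg o v = #|X|.
    have := @sum_indeg o setT; rewrite insideT setIT => <-; last by move=> e _ _; rewrite inE.
    rewrite [RHS](bigID (mem W)) /=; congr (_ + _); apply: eq_bigl => v; by rewrite !inE.
  have tXE := tightE tX; rewrite insideT setIT cardsT in tXE.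
  have cW := cardsC W.
  (* Sparsity says nothing about an empty complement; then the root lies in [W], and its target 0
     saves the same [m]. *)
  have := @sum_indeg o (~: W); have [CW|CW] := eqVneq (~: W) set0.
    rewrite CW big_set0 addn0 in tot; move=> _.
    have WT : W = setT by rewrite -[W]setCK CW setC0.
    by move: le1; rewrite WT inE cardsT muln1 -tXE -{1}WT => le1; lia.
  move=> sumC; have := sX _ CW; rewrite -sumC; last first.
    move=> e eX; rewrite !inE => h; apply: contra h => h.
    by apply: connect_trans h (connect1 _); apply/existsP; exists e; rewrite eX !eqxx.
  have : m * #|W| + m * #|~: W| = m * #|T| by rewrite -mulnDr cW.
  lia.
have [v vW tv] := over.
move: vW; rewrite inE => /connectP[p pp lp]; rewrite lp in tv.
case/shortenP: pp tv => p' pp' up' _ tv.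
have [o' lt] := flip_path pp' up' lu tv.
by have := omin o' isT; rewrite leqNgt lt.
Qed.

(** A set [W] avoiding the root has indegrees summing to at least [m * #|W|] but spans [m] edges
    fewer, so [m] arcs enter it and Edmonds' theorem applies. *)
Theorem tree_packing : sparse ends m X -> tight ends m X setT ->
  exists Ts : nat -> {set E}, (forall i, i < m -> [/\ Ts i \subset X, #|Ts i|.+1 = #|T| &
     forall x, connect (adjE ends (Ts i)) r x]) /\
   (forall i j, i < m -> j < m -> i != j -> [disjoint Ts i & Ts j]).
Proof.
move=> sX tX; have [o ho] := orientation_exists sX tX.
apply: (@arborescence_packing _ _ ends (ohead o) (otail o)); first exact: joins_otail.
move=> W W0 rW; have := sparseP _ _ _ sX W W0.
have h1 : m * #|W| <= \sum_(v in W) indeg o v.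
  rewrite mulnC -sum_nat_const; apply: leq_sum => v vW; apply: leq_trans (ho v).
  by rewrite /target; case: eqVneq => // vr; rewrite -vr vW in rW.
have h2 : \sum_(v in W) indeg o v <= #|X :&: inside ends W| + #|entering (ohead o) (otail o) X W|.
  apply: leq_trans (leq_of_leqif (leq_card_setU _ _)).
  apply: (@leq_trans #|[set e in X | ohead o e \in W]|).
    rewrite -[leqRHS]sum1_card (partition_big (ohead o) (mem W)) /=; last first.
      by move=> e; rewrite inE => /andP[].
    apply: leq_sum => v vW; rewrite /indeg -sum1_card; apply/eq_leq/eq_bigl => e.
    by rewrite !inE; case: (e \in X) => //=; case: eqVneq => [->|]; rewrite ?vW ?andbF.
  apply/subset_leq_card/subsetP=> e; rewrite !inE => /andP[-> ] /=.
  by rewrite /ohead /otail; case: (o e); case: (_ \in W); case: (_ \in W).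
by move: h1 h2; clear; lia.
Qed.

End Orientation.

(** * Spanning trees recognized by their number of edges *)

Lemma adjE_sym (T E : finType) (ends : E -> T * T) A : symmetric (adjE ends A).
Proof. by move=> x y; apply: eq_existsb => e; rewrite /joins orbC. Qed.

Lemma card_connected (T E : finType) (ends : E -> T * T) (A : {set E}) r :
  (forall x, connect (adjE ends A) r x) -> #|T| <= #|A|.+1.
Proof.
move=> conA; pose e0 : rel T := fun _ _ => false.
have s0 : symmetric e0 by [].
have d0 : pairwise_disconnected e0 [set: T].
  by move=> x y _ _ /connectP[[|z p] //=].
have [P [_ cP] dP] := pairwise_disconnected_add [seq ends e | e <- enum A] s0 d0.
apply: (leq_trans (n := #|P| + #|A|)); first by move: cP; rewrite cardsT size_map -cardE.
rewrite -[leqRHS]add1n leq_add2r; apply/card_le1_eqP=> x y xP yP; apply: dP => //.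
have sub z t : connect (adjE ends A) z t -> connect (add_edges e0 [seq ends e | e <- enum A]) z t.
  apply: connect_sub => {}z {}t /existsP[e /andP[eA ezt]]; apply: connect1.
  have hm : ends e \in [seq ends e | e <- enum A] by apply: map_f; rewrite mem_enum.
  by rewrite /add_edges; case/orP: ezt => /eqP<-; rewrite hm ?orbT.
apply: sub; have cs := sym_connect_sym (adjE_sym ends A).
by apply: connect_trans (conA x); rewrite cs.
Qed.

Lemma spanning_treeP (T E : finType) (ends : E -> T * T) (A : {set E}) r :
  (forall x, connect (adjE ends A) r x) -> #|A|.+1 = #|T| -> spanning_tree ends A.
Proof.
move=> conA cA; have cs := sym_connect_sym (adjE_sym ends A).
apply/andP; split.
  apply/forallP=> x; apply/forallP=> y; apply: connect_trans (conA y).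
  by rewrite cs.
apply/forall_inP=> e eA; apply/negP=> cyc.
have cs' := sym_connect_sym (adjE_sym ends (A :\ e)).
suff : #|T| <= #|A :\ e|.+1 by rewrite -cA (cardsD1 e A) eA ltnn.
apply: (@card_connected _ _ ends _ r) => x; apply: connect_sub (conA x) => y z.
case/existsP=> d /andP[dA]; have [->|nde] := eqVneq d e.
  by case/orP=> /eqP E'; rewrite E' // cs' in cyc *.
by move=> dyz; apply: connect1; apply/existsP; exists d; rewrite in_setD1 nde dA.
Qed.

Theorem tree_connected_of_tight (T E : finType) (ends : E -> T * T) m (X F : {set E}) :
  0 < #|T| -> sparse ends m X -> tight ends m X setT -> X \subset F ->
  tree_connected ends m F.
Proof.
case/card_gt0P=> r _ sX tX XF.
have [Ts [H1 H2]] := tree_packing r sX tX.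
exists (fun i => Ts i); split; [|split] => [i|i|i j nij].
- by have [h _ _] := H1 i (ltn_ord i); apply: subset_trans h XF.
- by have [_ h1 h2] := H1 i (ltn_ord i); apply: spanning_treeP h2 h1.
- exact: H2.
Qed.

(** * Counting components *)

Section Degrees.
Variables (T E : finType) (ends : E -> T * T).
Hypothesis noloop : forall e, (ends e).1 != (ends e).2.
Implicit Types (C X : {set E}) (V : {set T}).

Lemma sum_deg C : \sum_v deg ends C v = 2 * #|C|.
Proof.
transitivity (\sum_v \sum_(e in C) (incident ends v e : nat)).
  apply: eq_bigr => v _; rewrite /deg -sum1_card big_mkcond [RHS]big_mkcond /=.
  by apply: eq_bigr => e _; rewrite inE; case: (e \in C); case: incident.
rewrite exchange_big mulnC -sum_nat_const; apply: eq_bigr => e _ /=.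
have nl := noloop e.
rewrite (bigD1 (ends e).1) //= (bigD1 (ends e).2) /=; last by rewrite eq_sym.
rewrite /incident !eqxx orbT big1 // => v /andP[/negbTE h1 /negbTE h2].
by rewrite eq_sym h1 eq_sym h2.
Qed.

Lemma deg_gt0 C v : (0 < deg ends C v) = (v \in covered ends C).
Proof.
rewrite /deg; apply/card_gt0P/coveredP => -[e]; first by rewrite inE => /andP[h1 h2]; exists e.
by exists e; rewrite // inE; apply/andP.
Qed.

Lemma card_covered C : #|covered ends C| <= 2 * #|C|.
Proof.
rewrite -sum_deg -sum1_card big_mkcond; apply: leq_sum => v _.
by rewrite -deg_gt0; case: (deg _ _ _).
Qed.

(** By sparsity every nonempty vertex set spans a graph of average degree below [2m]. Hence greedily
    choosing a vertex of small degree discards at most [2m - 1] others. *)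
Lemma sparse_independent m X V : 0 < m -> sparse ends m X ->
  exists2 K : {set T}, K \subset V & {in K &, forall x y, ~~ adjE ends X x y} /\ #|V| <= 2 * m * #|K|.
Proof.
move=> m0 sX; have [n le_n] := ubnP #|V|; elim: n V le_n => // n IH V le_n.
have [->|V0] := eqVneq V set0.
  by exists set0 => //; rewrite cards0; split=> // x y; rewrite inE.
pose XV := X :&: inside ends V.
have cXV : #|XV| + m <= m * #|V| by apply: (sparseP _ _ _ sX).
have [v vV dv] : exists2 v, v \in V & deg ends XV v < 2 * m.
  apply/exists_inP; apply: contraT; rewrite negb_exists_in => /forall_inP h.
  have : \sum_(v in V) 2 * m <= \sum_v deg ends XV v.
    rewrite [leqRHS](bigID (mem V)) /=; apply: leq_trans (leq_addr _ _).
    by apply: leq_sum => v /h; rewrite -leqNgt.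
  by rewrite sum_nat_const sum_deg; move: cXV m0; clear; nia.
pose Nv := [set w in V | adjE ends X v w].
have cN : #|Nv| <= deg ends XV v.
  pose other e := if (ends e).1 == v then (ends e).2 else (ends e).1.
  apply: leq_trans (leq_imset_card other _); apply/subset_leq_card/subsetP=> w.
  rewrite inE => /andP[wV /existsP[e /andP[eX evw]]]; apply/imsetP; exists e.
    by rewrite !inE eX /incident; case/orP: evw => /eqP-> /=; rewrite vV wV eqxx ?orbT.
  rewrite /other; case/orP: (evw) => /eqP ee; rewrite ee /= ?eqxx //.
  by have := noloop e; rewrite ee /= => /negbTE->.
have loop x : ~~ adjE ends X x x.
  apply/existsP=> -[e /andP[_ /orP[] /eqP ee]]; by have := noloop e; rewrite ee eqxx.
have lt : #|(V :\ v) :\: Nv| < n.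
  apply: leq_trans (_ : #|V| <= _); last by [].
  by rewrite [in ltnRHS](cardsD1 v V) vV add1n ltnS subset_leq_card ?subsetDl.
have [K KV [indK cK]] := IH _ lt.
have vK : v \notin K by apply/negP=> /(subsetP KV); rewrite !inE eqxx andbF.
exists (v |: K).
  by apply/subsetP=> x /setU1P[->//|/(subsetP KV)]; rewrite !inE => /andP[_ /andP[]].
have vx x : x \in K -> ~~ adjE ends X v x.
  move/(subsetP KV); rewrite !inE => /and3P[h _ xV]; by rewrite xV in h.
split.
  move=> x y /setU1P[->|xK] /setU1P[->|yK] //; first exact: vx.
    by rewrite adjE_sym vx.
  exact: indK.
have : #|V| <= #|(V :\ v) :\: Nv| + #|Nv| + 1.
  rewrite [leqLHS](cardsD1 v V) vV addnC leq_add2r -(cardsID Nv (V :\ v)) addnC leq_add2l.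
  by rewrite subset_leq_card ?subsetIr.
rewrite cardsU1 vK; move: cN dv cK; clear.
move: #|Nv| #|V| #|_| #|K| (deg _ _ _) => a b c d e h1 h2 h3 h4.
by rewrite mulnDr muln1; lia.
Qed.

End Degrees.

Section Counting.
Variables (T E : finType) (ends : E -> T * T) (m r : nat).
Hypothesis noloop : forall e, (ends e).1 != (ends e).2.
Variables (F X M : {set E}) (D : {set T}).
Hypothesis sX : sparse ends m X.
Hypothesis MX : M \subset X :\: F.

Notation cls := (cls ends m (X :\: M)).
Notation within e := ((ends e).2 \in cls (ends e).1).

Hypothesis within_F : forall e, e \in F -> e \notin X -> within e.
Hypothesis within_L : forall e, e \notin F ->
  (forall v, incident ends v e -> v \notin covered ends M :|: D) -> within e.
Hypothesis F_deg : forall v, r <= deg ends F v.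
Hypothesis F_simple : forall e d, e \in F -> d \in F ->
  joins ends d (ends e).1 (ends e).2 -> d = e.
Hypotheses (m_gt0 : 0 < m) (le_r : 2 * m <= r).
Hypothesis not_tight : #|X| + m < m * #|T|.

Let sXo : sparse ends m (X :\: M).
Proof. exact: sparse_sub (subsetDl _ _) sX. Qed.

Let clsE x y : y \in cls x -> cls y = cls x.
Proof. exact: cls_eq. Qed.

Let x_cls x : x \in cls x.
Proof. exact: mem_cls. Qed.

Let classes : {set {set T}} := [set cls x | x in [set: T]].
Let crossing : {set E} := [set e in X | ~~ within e].
Let w (Z : {set T}) := \sum_(v in Z) deg ends crossing v.

Let classesP Z v : Z \in classes -> v \in Z -> Z = cls v.
Proof. by case/imsetP=> x _ -> vx; rewrite (clsE vx). Qed.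

Let cls_classes v : cls v \in classes.
Proof. by apply/imsetP; exists v. Qed.

Let sum_classes (h : T -> nat) : \sum_(Z in classes) \sum_(v in Z) h v = \sum_v h v.
Proof.
rewrite [RHS](partition_big (fun v => cls v) (mem classes)) /=; last by move=> v _; apply: cls_classes.
apply: eq_bigr => Z ZP; apply: eq_bigl => v; apply/idP/eqP => [vZ|<-]; last exact: x_cls.
by rewrite -(classesP ZP vZ).
Qed.

Let M_crossing e : e \in M -> e \in crossing.
Proof.
move=> eM; have /setDP[eX eF] := subsetP MX _ eM; rewrite inE eX; apply/negP=> we.
have tZ := tight_cls noloop (ends e).1 sXo.
have := subsetP (tight_inside_sub (subsetDl X M) sX tZ) e.
by rewrite in_setI eX inE x_cls we => /(_ isT); rewrite in_setD eM.
Qed.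

Let cov_deg v : v \in covered ends M -> 0 < deg ends crossing v.
Proof.
by rewrite deg_gt0; apply/subsetP/coveredS/subsetP=> e; apply: M_crossing.
Qed.

(** Every class is tight for [X], so it spans exactly [m (#|Z| - 1)] edges; the edges of [X] inside
    the union that lie in no class are the crossing ones. *)
Lemma count_classes (Q : {set {set T}}) : Q \subset classes ->
  (forall e, e \in crossing -> e \in inside ends (cover Q)) ->
  #|crossing| + m * #|cover Q| <= #|X :&: inside ends (cover Q)| + m * #|Q|.
Proof.
move=> QP crQ.
have memQ v : v \in cover Q -> cls v \in Q.
  by case/bigcupP=> Z ZQ vZ; rewrite -(classesP (subsetP QP _ ZQ) vZ).
have e1 : \sum_(Z in Q) #|X :&: inside ends Z| = #|(X :&: inside ends (cover Q)) :\: crossing|.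
  rewrite -[RHS]sum1_card (partition_big (fun e => cls (ends e).1) (mem Q)) /=; last first.
    by move=> e /setDP[/setIP[_]]; rewrite inE => /andP[h _] _; apply: memQ.
  apply: eq_bigr => Z ZQ; rewrite -sum1_card; apply: eq_bigl => e.
  have ZP := subsetP QP _ ZQ.
  apply/idP/idP.
    case/setIP=> eX; rewrite inE => /andP[h1 h2].
    have EZ := classesP ZP h1; rewrite -EZ eqxx andbT in_setD in_setI eX [e \in crossing]inE.
    rewrite eX -EZ h2 /= inE; apply/andP; split; apply/bigcupP; by exists Z.
  case/andP=> /setDP[/setIP[eX _]]; rewrite [e \in crossing]inE eX negbK => h /eqP <-.
  by rewrite in_setI eX inE x_cls h.
have e2 : \sum_(Z in Q) (#|X :&: inside ends Z| + m) = m * #|cover Q|.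
  have -> : #|cover Q| = \sum_(Z in Q) #|Z|.
    have tQ : trivIset Q.
      apply/trivIsetP=> Z1 Z2 /(subsetP QP) h1 /(subsetP QP) h2.
      apply: contraR; rewrite -setI_eq0 => /set0Pn[v /setIP[v1 v2]].
      by rewrite (classesP h1 v1) (classesP h2 v2).
    by rewrite (eqP tQ).
  rewrite big_distrr /=; apply: eq_bigr => Z /(subsetP QP)/imsetP[x _ ->].
  apply: tightE; apply: tightS (subsetDl X M) sX _; exact: tight_cls.
have e3 : #|crossing| + #|(X :&: inside ends (cover Q)) :\: crossing| = #|X :&: inside ends (cover Q)|.
  rewrite -[RHS](cardsID crossing); congr (_ + _); apply: eq_card => e; rewrite in_setI.
  case: (boolP (e \in crossing)) => ec; rewrite ?andbF // andbT in_setI crQ //.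
  by move: ec; rewrite inE => /andP[->].
by rewrite -e2 big_split /= e1 -e3 sum_nat_const addnA (mulnC m) leqnn.
Qed.

Let q := #|classes|.
Let zero : {set {set T}} := [set Z in classes | w Z == 0].

Lemma crossing_lt : #|crossing| + m < m * q.
Proof.
have cT : cover classes = setT.
  by apply/setP=> v; rewrite inE; apply/bigcupP; exists (cls v).
have := @count_classes classes (subxx _); rewrite cT insideT setIT cardsT.
move=> /(_ (fun e _ => in_setT e)); move: not_tight; rewrite /q; lia.
Qed.

Let sum_w : \sum_(Z in classes) w Z = 2 * #|crossing|.
Proof. by rewrite sum_classes sum_deg. Qed.

(** Classes without crossing edges contribute no end to the final count. In return, sparsity on the
    union of the other classes sharpens the bound on the crossing edges, unless there are none. *)
Lemma crossing_zero : #|zero| = q /\ #|crossing| = 0 \/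
  #|zero| < q /\ #|crossing| + m + m * #|zero| <= m * q.
Proof.
have zP : zero \subset classes by apply/subsetP=> Z; rewrite inE => /andP[].
have [E0|ne] := eqVneq zero classes.
  left; split; first by rewrite E0.
  have : \sum_(Z in classes) w Z = 0.
    by rewrite big1 // => Z; rewrite -E0 inE => /andP[_ /eqP].
  by rewrite sum_w; lia.
right; have lt : #|zero| < q by apply: proper_card; rewrite properEneq ne.
split=> //; pose Q := classes :\: zero.
have cQ : #|Q| + #|zero| = q.
  by rewrite /q -(cardsID zero classes) addnC (setIidPr zP).
have QP : Q \subset classes by apply: subsetDl.
have mQ v : v \in covered ends crossing -> v \in cover Q.
  rewrite -deg_gt0 => dv; apply/bigcupP; exists (cls v) => //.
  rewrite in_setD cls_classes andbT inE cls_classes /= -lt0n.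
  by rewrite /w (bigD1 v) //=; apply: leq_trans dv (leq_addr _ _).
have crQ e : e \in crossing -> e \in inside ends (cover Q).
  move=> ec; rewrite inE; apply/andP; split; apply: mQ; apply/coveredP; exists e => //.
    by rewrite /incident eqxx.
  by rewrite /incident eqxx orbT.
have cov0 : cover Q != set0.
  have /set0Pn[Z ZQ] : Q != set0 by rewrite -card_gt0; move: cQ lt; lia.
  have /imsetP[x _ EZ] := subsetP QP _ ZQ; apply/set0Pn; exists x.
  by apply/bigcupP; exists Z => //; rewrite EZ.
have := count_classes QP crQ; have := sparseP _ _ _ sX _ cov0.
have : m * #|Q| + m * #|zero| = m * q by rewrite -mulnDr cQ.
lia.
Qed.

Let S := D :|: covered ends crossing.
Let destroyed : {set {set T}} := [set Z in classes | Z \subset S].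
(** A class of [D2] has a vertex outside [D] not covered by [M], which is a candidate for being put
    back. In the remaining destroyed classes every vertex outside [D] carries an edge of [M], and
    this extra edge makes them heavier. *)
Let D2 : {set {set T}} := [set Z in destroyed | ~~ (Z \subset covered ends M :|: D)].
Let D1 := destroyed :\: D2.

(** The edges of [F] at [v] that do not cross lead to distinct vertices of [Z], since [F] has no
    parallel edges. An edge of [M] at [v] crosses too, and is not in [F]. *)
Lemma crossing_deg Z v : Z \in classes -> v \in Z ->
  r + (v \in covered ends M) <= deg ends crossing v + #|Z|.-1.
Proof.
move=> ZP vZ; have EZ := classesP ZP vZ.
pose other e := if (ends e).1 == v then (ends e).2 else (ends e).1.
pose Fv := [set e in F | incident ends v e].
have inF e : e \in Fv -> e \notin crossing -> other e \in Z :\ v.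
  rewrite inE => /andP[eF ve] ec; rewrite in_setD1.
  have we : within e.
    case: (boolP (e \in X)) => eX; last exact: within_F.
    by move: ec; rewrite inE eX negbK.
  have := cls_closed noloop sXo we ve; rewrite -EZ inE => /andP[h1 h2].
  move: ve (noloop e); rewrite /other /incident; case: eqVneq => [->|n1] /=.
    by rewrite h2 eq_sym => _ ->.
  by move=> /eqP e2; rewrite h1 n1.
have inj : {in Fv :\: crossing &, injective other}.
  move=> e d /setDP[]; rewrite inE => /andP[eF ve] _ /setDP[]; rewrite inE => /andP[dF vd] _ Eod.
  apply/esym; apply: F_simple => //; move: ve vd Eod; rewrite /incident /other /joins.
  rewrite [ends d]surjective_pairing [ends e]surjective_pairing /= !xpair_eqE.
  case: (eqVneq (ends e).1 v) => [->|ne]; case: (eqVneq (ends d).1 v) => [->|nd] /=.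
  - by move=> _ _ ->; rewrite !eqxx.
  - by move=> _ /eqP-> ->; rewrite !eqxx ?orbT.
  - by move=> /eqP-> _ ->; rewrite !eqxx ?orbT.
  - by move=> /eqP-> /eqP-> ->; rewrite !eqxx.
have c1 : #|Fv :\: crossing| <= #|Z|.-1.
  rewrite -(card_in_imset inj); have -> : #|Z|.-1 = #|Z :\ v| by rewrite (cardsD1 v Z) vZ.
  apply/subset_leq_card/subsetP=> _ /imsetP[e /setDP[eF ec] ->]; exact: inF.
have c2 : #|Fv :&: crossing| + (v \in covered ends M) <= deg ends crossing v.
  rewrite /deg -(cardsID F [set e in crossing | incident ends v e]).
  apply: leq_add.
    apply/subset_leq_card/subsetP=> e /setIP[]; rewrite inE => /andP[eF ve] ec.
    by rewrite in_setI inE ec ve eF.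
  case: (boolP (v \in covered ends M)) => // /coveredP[e eM ve].
  apply/card_gt0P; exists e; rewrite in_setD inE M_crossing // ve /=.
  by have /setDP[_ ->] := subsetP MX _ eM.
have := F_deg v; rewrite {1}/deg -/Fv -(cardsID crossing Fv).
move: c1 c2; clear; lia.
Qed.

Let card_covered_class Z : #|Z :&: covered ends crossing| <= w Z.
Proof.
rewrite -sum1_card big_mkcond /w [leqRHS]big_mkcond; apply: leq_sum => v _.
by rewrite in_setI -deg_gt0; case: (v \in Z) => //=; case: (deg _ _ _).
Qed.

Let class_gt0 Z : Z \in classes -> 0 < #|Z|.
Proof. by case/imsetP=> x _ ->; apply/card_gt0P; exists x. Qed.

Let destroyed_card Z : Z \in destroyed -> #|Z| <= w Z + #|Z :&: D|.
Proof.
rewrite inE => /andP[_ ZS]; rewrite addnC; apply: leq_trans (leq_add (leqnn _) (card_covered_class Z)).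
apply: leq_trans (leq_of_leqif (leq_card_setU _ _)); rewrite -setIUr.
by apply: subset_leq_card; rewrite subsetI subxx.
Qed.

(** A class with more than [r] vertices has all of them, up to one in [D], on crossing edges. With
    [n <= r] vertices, each has at least [r - n + 1] crossing edges, and [n (r - n + 1) >= r]. *)
Lemma destroyed_weight Z : #|D| <= 1 -> Z \in destroyed -> r <= w Z.
Proof.
move=> cD Zd; have Zc := destroyed_card Zd.
have ZP : Z \in classes by move: Zd; rewrite inE => /andP[].
have ZD : #|Z :&: D| <= 1 by apply: leq_trans cD; apply/subset_leq_card/subsetIr.
case: (ltnP r #|Z|) => rZ; first by move: Zc ZD rZ; clear; lia.
have Z0 := class_gt0 ZP.
apply: (@leq_trans (#|Z| * (r - #|Z|.-1))).
  move: Z0 rZ; move: #|Z| => [|z] // _ zr /=; rewrite -[X in X <= _](subnK (ltnW zr)).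
  have : 0 < r - z by rewrite subn_gt0.
  by move: (r - z) => [|y] // _; rewrite mulSn mulnS; lia.
rewrite -sum_nat_const; apply: leq_sum => v vZ; rewrite leq_subLR addnC.
by apply: leq_trans (crossing_deg ZP vZ); apply: leq_addr.
Qed.

(** The extra unit comes from the edge of [M] at each vertex or, if the class meets [D], from the
    vertex in [D]. *)
Lemma D1_weight Z : #|D| <= 1 -> Z \in D1 -> r < w Z + #|Z :&: D|.
Proof.
move=> cD /setDP[Zd ZD2]; have Zc := destroyed_card Zd.
have ZP : Z \in classes by move: Zd; rewrite inE => /andP[].
case: (posnP #|Z :&: D|) => ZD; last first.
  by apply: leq_trans (leq_add (destroyed_weight cD Zd) ZD); rewrite addn1.
rewrite ZD addn0 in Zc *.
have Zcov v : v \in Z -> v \in covered ends M.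
  move=> vZ; move: ZD2; rewrite inE Zd negbK => /subsetP/(_ v vZ)/setUP[//|vD].
  by move/eqP: ZD; rewrite cards_eq0 => /eqP/setP/(_ v); rewrite in_setI vZ vD inE.
case: (ltnP r #|Z|) => rZ; first exact: leq_trans Zc.
have Z0 := class_gt0 ZP.
apply: (@leq_trans (#|Z| * (r.+1 - #|Z|.-1))).
  move: Z0 rZ; move: #|Z| => [|z] // _ zr /=; rewrite subSn ?(ltnW zr) //.
  rewrite -[X in X < _](subnK (ltnW zr)).
  have : 0 < r - z by rewrite subn_gt0.
  by move: (r - z) => [|y] // _; rewrite mulSn mulnS; lia.
rewrite -sum_nat_const; apply: leq_sum => v vZ; rewrite leq_subLR addnC -addn1.
by apply: leq_trans (crossing_deg ZP vZ); rewrite Zcov.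
Qed.

(** Each class is charged for the ends of crossing edges it contains, a surviving one for a single
    end; [zero] compensates for the survivors that have none. *)
Lemma weight_count : #|D| <= 1 ->
  #|D1| * r.+1 + #|D2| * r + (q - #|D1| - #|D2|) <= 2 * #|crossing| + #|D| + #|zero|.
Proof.
move=> cD.
have sD2 : D2 \subset destroyed by apply/subsetP=> Z; rewrite inE => /andP[].
have sd : destroyed \subset classes by apply/subsetP=> Z; rewrite inE => /andP[].
have -> : #|D1| * r.+1 + #|D2| * r + (q - #|D1| - #|D2|) =
  \sum_(Z in classes) (if Z \in D1 then r.+1 else if Z \in D2 then r else 1).
  rewrite (bigID (mem D1)) /= (bigID (mem D2) (fun Z => (Z \in classes) && (Z \notin D1))) /= addnA.
  have c3 : #|D1| + #|D2| + #|classes :\: destroyed| = q.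
    rewrite /q -(cardsID destroyed classes) (setIidPr sd); congr (_ + _).
    by rewrite -(cardsID D2 destroyed) (setIidPr sD2) addnC.
  congr (_ + _ + _).
  - rewrite -sum_nat_const; apply: eq_big => [Z|Z ->] //.
    by case: (boolP (Z \in D1)) => [/setDP[Zd _]|_]; rewrite ?andbF // (subsetP sd).
  - rewrite -sum_nat_const; apply: eq_big => [Z|Z ZD2].
      case: (boolP (Z \in D2)) => ZD2; rewrite ?andbF // andbT (subsetP sd) ?(subsetP sD2) //=.
      by rewrite in_setD ZD2.
    by rewrite in_setD ZD2.
  - transitivity #|classes :\: destroyed|; first by rewrite -c3 -subnDA addKn.
    have D1d Z : Z \notin destroyed -> (Z \notin D1) && (Z \notin D2).
      move=> Zd; rewrite in_setD (negbTE Zd) andbF /=.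
      by apply: contra Zd; apply: (subsetP sD2).
    rewrite -sum1_card; apply: eq_big => [Z|Z /setDP[_ /D1d/andP[/negbTE-> /negbTE->]] //].
    rewrite in_setD andbC -andbA; case: (boolP (Z \in classes)) => //= ZP.
    apply/idP/idP => [/D1d //|/andP[]]; rewrite in_setD negb_and negbK.
    by case/orP=> [->//|].
have -> : #|zero| = \sum_(Z in classes) (w Z == 0 : nat).
  rewrite -sum1_card /zero big_mkcond [RHS]big_mkcond; apply: eq_bigr => Z _.
  by rewrite inE; case: (Z \in classes) => //=; case: eqP.
have : \sum_(Z in classes) #|Z :&: D| <= #|D|.
  have -> : #|D| = \sum_v (v \in D : nat).
    by rewrite -sum1_card big_mkcond; apply: eq_bigr => v _; case: (v \in D).
  rewrite -(sum_classes (fun v => v \in D : nat)); apply: leq_sum => Z _.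
  rewrite -sum1_card big_mkcond [leqRHS]big_mkcond; apply: leq_sum => v _.
  by rewrite in_setI; case: (v \in Z); case: (v \in D).
rewrite -sum_w => le1.
apply: leq_trans (leq_add (leq_add (leqnn _) le1) (leqnn _)).
rewrite -!big_split /=; apply: leq_sum => Z ZP.
case: ifP => [ZD1|_]; first exact: leq_trans (D1_weight cD ZD1) (leq_addr _ _).
case: ifP => [ZD2|_].
  apply: leq_trans (destroyed_weight cD (subsetP sD2 _ ZD2)) _.
  by rewrite -addnA leq_addr.
by case: (w Z) => [|k]; rewrite ?addn1 /= -?addnA ?addSn.
Qed.

(* Vertices of an independent choice of representatives of [D2] are put back: each of them
   revives its class, because all its neighbours in other classes stay deleted. *)
Lemma component_count : #|D| <= 1 -> exists (S' : {set T}) k,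
  [/\ #|D2| <= 2 * m * k, k <= #|D2|, q + k <= ncomp ends S' + #|D1| + #|D2| &
      #|S'| + k <= 2 * #|crossing| + #|D|].
Proof.
move=> cD.
have sD2 : D2 \subset destroyed by apply/subsetP=> Z; rewrite inE => /andP[].
have sd : destroyed \subset classes by apply/subsetP=> Z; rewrite inE => /andP[].
pose rep (Z : {set T}) := [pick v in Z :\: (covered ends M :|: D)].
have repP Z : Z \in D2 -> exists v, [/\ rep Z = Some v, v \in Z & v \notin covered ends M :|: D].
  rewrite inE => /andP[_ /subsetPn[v vZ vn]]; rewrite /rep; case: pickP => [u /setDP[h1 h2]|/(_ v)].
    by exists u.
  by rewrite in_setD vZ vn.
pose V0 := [set v | [exists Z in D2, rep Z == Some v]].
have V0P v : v \in V0 -> [/\ cls v \in D2, rep (cls v) = Some v & v \notin covered ends M :|: D].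
  rewrite inE => /exists_inP[Z ZD2 /eqP rZ]; have [u [ru uZ un]] := repP _ ZD2.
  move: rZ; rewrite ru => -[<-]; have EZ := classesP (subsetP sd _ (subsetP sD2 _ ZD2)) uZ.
  by rewrite -EZ.
have clsV0 : [set cls v | v in V0] = D2.
  apply/setP=> Z; apply/imsetP/idP => [[v /V0P[h _ _] -> //]|ZD2].
  have [v [rv vZ vn]] := repP _ ZD2.
  have EZ := classesP (subsetP sd _ (subsetP sD2 _ ZD2)) vZ.
  by exists v => //; rewrite inE; apply/exists_inP; exists Z; rewrite ?rv.
have injV0 : {in V0 &, injective (fun v => cls v)}.
  by move=> u v /V0P[_ ru _] /V0P[_ rv _] Euv; move: ru; rewrite Euv rv => -[].
have cV0 : #|V0| = #|D2| by rewrite -clsV0 card_in_imset.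
have [K KV [indK cK]] := sparse_independent noloop V0 m_gt0 sX.
have KP v : v \in K -> [/\ cls v \in D2, v \notin covered ends M & v \notin D].
  by move/(subsetP KV)/V0P => [h1 _]; rewrite in_setU negb_or => /andP[].
have KS v : v \in K -> v \in covered ends crossing.
  move=> vK; have [h1 _ vD] := KP _ vK.
  have := subsetP sD2 _ h1; rewrite inE => /andP[_ /subsetP/(_ v (x_cls v))].
  by rewrite in_setU (negbTE vD).
exists (S :\: K), #|K|; split.
- by rewrite -cV0.
- by rewrite -cV0; apply: subset_leq_card.
(* A crossing edge of [F] with no deleted end would join two vertices of the independent set [K]. An
   edge outside [F] with no deleted end avoids [D] and the vertices covered by [M], so it lies
   within a class. *)
- have wE e : (forall v, incident ends v e -> v \notin S :\: K) -> within e.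
    move=> he; have h1 : incident ends (ends e).1 e by rewrite /incident eqxx.
    have h2 : incident ends (ends e).2 e by rewrite /incident eqxx orbT.
    case: (boolP (e \in F)) => eF.
      case: (boolP (e \in X)) => eX; last exact: within_F.
      apply: contraT => we; have ec : e \in crossing by rewrite inE eX.
      have inK v : incident ends v e -> v \in K.
        move=> ve; have := he v ve; rewrite in_setD negb_and negbK => /orP[//|].
        by rewrite in_setU negb_or => /andP[_ /coveredP[]]; exists e.
      have /negP[] := indK _ _ (inK _ h1) (inK _ h2).
      by apply/existsP; exists e; rewrite eX /joins -surjective_pairing eqxx.
    apply: within_L => // v ve; rewrite in_setU negb_or.
    have := he v ve; rewrite in_setD negb_and negbK => /orP[vK|].
      by have [_ -> ->] := KP _ vK.
    rewrite in_setU negb_or => /andP[-> h3]; rewrite andbT.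
    by apply: contra h3 => /cov_deg; rewrite deg_gt0.
  have con x y : connect (adjDel ends (S :\: K)) x y -> y \in cls x.
    case/connectP=> p; elim/last_ind: p y => [|p z IH] y /=; first by move=> _ ->.
    rewrite rcons_path last_rcons => /andP[pp /andP[/andP[h1 h2] /existsP[e je]]] ->.
    have lx := IH _ pp erefl; rewrite -(clsE lx).
    have he v : incident ends v e -> v \notin S :\: K.
      by rewrite /incident; case/orP: je => /eqP-> /= /orP[] /eqP<-.
    have := wE _ he; case/orP: je => /eqP-> //= h.
    by rewrite (clsE h).
  pose alive := [set cls x | x in ~: (S :\: K)].
  have le1 : #|alive| <= ncomp ends (S :\: K).
    pose phi (C : {set T}) := if [pick y in C] is Some y then cls y else set0.
    apply: leq_trans (leq_imset_card phi _); apply/subset_leq_card/subsetP=> _ /imsetP[x xS ->].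
    apply/imsetP; exists [set y | connect (adjDel ends (S :\: K)) x y].
      by apply/imsetP; exists x.
    rewrite /phi; case: pickP => [y|/(_ x)]; last by rewrite inE connect0.
    by rewrite inE => /con/clsE ->.
  apply: leq_trans (leq_add (leq_add le1 (leqnn _)) (leqnn _)).
  have cd : #|D1| + #|D2| = #|destroyed|.
    by rewrite -(cardsID D2 destroyed) (setIidPr sD2) addnC.
  rewrite -addnA cd.
  have cKc : #|[set cls v | v in K]| = #|K|.
    by rewrite card_in_imset // => u v /(subsetP KV) uV /(subsetP KV) vV; apply: injV0.
  have q2 : q = #|classes :\: destroyed| + #|destroyed|.
    by rewrite /q -(cardsID destroyed classes) (setIidPr sd) addnC.
  rewrite q2 addnAC leq_add2r -cKc -cardsUI.
  rewrite [X in _ + #|pred_of_set X|](_ : _ = set0) ?cards0 ?addn0; last first.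
    apply/setP=> Z; rewrite in_setI in_set0; apply/negP=> /andP[/setDP[_ nd] /imsetP[v vK EZ]].
    by have [h _ _] := KP _ vK; move: nd; rewrite EZ (subsetP sD2).
  apply/subset_leq_card/subsetP=> Z /setUP[/setDP[ZP nd]|/imsetP[v vK ->]].
    move: nd; rewrite inE ZP /= => /subsetPn[v vZ vS]; apply/imsetP; exists v.
      by rewrite in_setC in_setD negb_and vS orbT.
    exact: classesP.
  by apply/imsetP; exists v; rewrite // in_setC in_setD negb_and negbK vK.
- have cSK : #|S :\: K| + #|K| = #|S|.
    rewrite -(cardsID K S) addnC; congr (_ + _); apply: eq_card => v; rewrite in_setI.
    by case: (boolP (v \in K)) => vK; rewrite ?andbF // andbT in_setU KS ?orbT.
  rewrite cSK addnC; apply: leq_trans (leq_of_leqif (leq_card_setU _ _)) _.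
  by rewrite leq_add2l card_covered.
Qed.

(** The [s2] classes of [D2] may fall short of weight [r + 1] by one each; as [s2 <= 2m k <= r k],
    the [k] revived classes make up for it. *)
Lemma component_bound : #|D| <= 1 -> exists (S' : {set T}) c q z s1 s2 k,
  [/\ c + m < m * q, (z = q /\ c = 0) \/ (z < q /\ c + m + m * z <= m * q),
      r * (s1 + s2) + q <= 2 * c + 1 + z + r * k,
      k <= s2 & q + k <= ncomp ends S' + s1 + s2 /\ #|S'| + k <= 2 * c + 1].
Proof.
move=> cD; have [S' [k [h1 h2 h3 h4]]] := component_count cD.
exists S', #|crossing|, q, #|zero|, #|D1|, #|D2|, k; split=> //.
- exact: crossing_lt.
- exact: crossing_zero.
- have rk : 2 * m * k <= r * k by rewrite leq_mul2r le_r orbT.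
  have := weight_count cD; move: h1 rk cD; clear; rewrite mulnS mulnDr !(mulnC r).
  move: #|D1| #|D2| #|crossing| #|zero| #|D| q (2 * m * k) (k * r) => a b c z d p x y.
  by move: (a * r) (b * r) => ar br; lia.
- by split=> //; apply: leq_trans h4 _; rewrite leq_add2l.
Qed.

End Counting.

(** One edge is chosen for each adjacent pair. The choice depends only on the unordered pair, which
    keeps degrees exact and excludes parallel edges. *)
Lemma edge_set_of_rel (T E : finType) (ends : E -> T * T) (h : rel T) :
  (forall e, (ends e).1 != (ends e).2) -> symmetric h ->
  (forall x y, h x y -> exists e, joins ends e x y) ->
  exists F : {set E}, (forall v, deg ends F v = #|[set w | h v w]|) /\
    forall e d, e \in F -> d \in F -> joins ends d (ends e).1 (ends e).2 -> d = e.
Proof.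
move=> noloop hs hg; pose ch x y := [pick d | joins ends d x y].
have chC x y : ch x y = ch y x by apply: eq_pick => d; rewrite /joins orbC.
exists [set e | h (ends e).1 (ends e).2 && (ch (ends e).1 (ends e).2 == Some e)]; split; last first.
  move=> e d; rewrite !inE => /andP[_ /eqP ce] /andP[_ /eqP cd] /orP[] /eqP Ed.
    by move: cd; rewrite Ed /= ce => -[].
  by move: cd; rewrite Ed /= chC ce => -[].
move=> v; rewrite /deg; set A := [set e in _ | incident _ _ e]; pose other e := if (ends e).1 == v then (ends e).2 else (ends e).1.
have hother e : e \in A -> h v (other e) && (ch v (other e) == Some e).
  rewrite !inE /incident /other => /andP[/andP[h1 h2] ve].
  move: ve; case: eqVneq => [<- _|_ /= /eqP <-]; first by rewrite h1.
  by rewrite hs h1 chC.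
have inj : {in A &, injective other}.
  move=> e d /hother/andP[_ /eqP ce] /hother/andP[_ /eqP cd] Eo.
  by move: cd; rewrite -Eo ce => -[].
rewrite -(card_in_imset inj); apply: eq_card => w; apply/imsetP/idP => [[e /hother/andP[he _] ->]|].
  by rewrite inE.
rewrite inE => hw; have [e0 je0] := hg _ _ hw.
have [e ce je] : exists2 e, ch v w = Some e & joins ends e v w.
  by rewrite /ch; case: pickP => [d jd|/(_ e0)]; [exists d | rewrite je0].
have nvw : v != w.
  by case/orP: je (noloop e) => /eqP-> //=; rewrite eq_sym.
exists e; last by rewrite /other; case/orP: je => /eqP-> /=; rewrite ?eqxx // eq_sym (negbTE nvw).
by rewrite !inE /incident; case/orP: je => /eqP-> /=; rewrite ?hw ?(hs w) ?hw ?(chC w) ce !eqxx ?orbT.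
Qed.

(** * The numerical contradiction and the assembly *)

Local Open Scope ring_scope.

(** In the proof [sg] is the net number of classes lost. The ends available bound it above by about
    [(2m - 1)(q - 1) / r], toughness bounds it below by about [eps (q - 1) / (2m + eps)], and the
    hypothesis on [r] makes these incompatible. *)
Lemma gap_contradiction (R : realFieldType) (eps : R) (m r c q z s1 s2 k n s : nat) :
  0 < eps -> (0 < m)%N -> (2 * m%:R - 1) * (2 * m%:R / eps + 1) <= r%:R :> R ->
  (c + m < m * q)%N -> (z = q /\ c = 0%N) \/ ((z < q)%N /\ (c + m + m * z <= m * q)%N) ->
  (r * (s1 + s2) + q <= 2 * c + 1 + z + r * k)%N ->
  (k <= s2)%N -> (q + k <= n + s1 + s2)%N -> (s + k <= 2 * c + 1)%N ->
  n%:R <= s%:R / (2 * m%:R + eps) + 1 :> R -> False.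
Proof.
move=> eps0 m0 hr N1 N2 N3 N4 N5 N6 hn.
pose t : R := 2 * m%:R + eps; pose a : R := 2 * m%:R - 1.
have m1 : 1 <= m%:R :> R by rewrite ler1n.
have a1 : 1 <= a by rewrite /a; lra.
have t0 : 0 < t by rewrite /t; lra.
have hre : a * t <= r%:R * eps.
  have te : t = (2 * m%:R / eps + 1) * eps by rewrite mulrDl mul1r divfK // gt_eqF.
  by rewrite te mulrA ler_pM2r.
have hnt : (n%:R - 1) * t <= s%:R.
  by rewrite -ler_pdivlMr // lerBlDr.
pose x : R := 2 * c%:R + 1.
pose sg : R := s1%:R + s2%:R - k%:R.
have sg0 : 0 <= sg.
  have : k%:R <= s2%:R :> R by rewrite ler_nat.
  by have := ler0n R s1; rewrite /sg; lra.
have xE : (2 * c + 1)%:R = x by rewrite natrD natrM.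
have hA : r%:R * sg <= x + z%:R - q%:R.
  have : (r * (s1 + s2) + q)%:R <= (2 * c + 1 + z + r * k)%:R :> R by rewrite ler_nat.
  rewrite [LHS in LHS <= _]natrD natrM (natrD _ s1) natrD (natrD _ (2 * c + 1)) xE natrM.
  by rewrite /sg mulrBr; lra.
have hB : q%:R - sg <= n%:R.
  have : (q + k)%:R <= (n + s1 + s2)%:R :> R by rewrite ler_nat.
  by rewrite !natrD /sg; lra.
have hC : s%:R <= x.
  by rewrite -xE ler_nat; apply: leq_trans N6; apply: leq_addr.
have hD : (q%:R - sg - 1) * t <= x.
  by apply: le_trans hC; apply: le_trans hnt; rewrite ler_pM2r //; lra.
have hE : a * t * sg <= eps * (x + z%:R - q%:R).
  apply: (@le_trans _ _ (r%:R * eps * sg)); first by rewrite ler_wpM2r.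
  by rewrite mulrAC mulrC ler_pM2l.
(* Adding [a] times [hD] to [hE] eliminates [sg], and [a + eps = t - 1]. *)
have key : a * (q%:R - 1) * t <= x * (t - 1) - eps * (q%:R - z%:R).
  have : a * ((q%:R - sg - 1) * t) <= a * x by rewrite ler_wpM2l //; lra.
  by rewrite /t /a in hE *; move: hE; nra.
have q1 : 1 < q%:R :> R by rewrite ltr1n; move: N1 m0; clear; nia.
have q2 : 2 <= q%:R :> R by rewrite ler_nat; move: N1 m0; clear; nia.
(* Without crossing edges at most one vertex is deleted, although there are at least two classes. *)
case: N2 => [[zq c0]|[zq N2]].
  have x1 : x = 1 by rewrite /x c0 mulr0 add0r.
  move: key; rewrite x1 zq subrr mulr0 subr0 mul1r.
  have : t * 1 <= t * (a * (q%:R - 1)) by rewrite ler_pM2l //; nra.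
  by lra.
have N2' : x <= 2 * m%:R * (q%:R - z%:R - 1) + 1.
  have : (c + m + m * z)%:R <= (m * q)%:R :> R by rewrite ler_nat.
  by rewrite !natrD !natrM /x; lra.
(* For [z = 0] the strict inequality [N1], the failure of tightness, is indispensable. For [z >= 1]
   the slack comes from replacing [q - 1] by [q - z]. *)
have [z0|z1] := posnP z.
  have N1' : x <= 2 * m%:R * (q%:R - 1) - 1.
    have : ((c + m).+1)%:R <= (m * q)%:R :> R by rewrite ler_nat.
    by rewrite -addn1 !natrD !natrM /x; lra.
  have : x * (t - 1) <= (2 * m%:R * (q%:R - 1) - 1) * (t - 1).
    by rewrite ler_wpM2r // /t; lra.
  move: key; rewrite z0 subr0 /t /a; nra.
have z1' : 1 <= z%:R :> R by rewrite ler1n.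
have : x * (t - 1) <= (2 * m%:R * (q%:R - z%:R - 1) + 1) * (t - 1).
  by rewrite ler_wpM2r // /t; lra.
have zq' : z%:R + 1 <= q%:R :> R by rewrite natr1 ler_nat.
have : a * (q%:R - z%:R) * t <= a * (q%:R - 1) * t.
  by rewrite ler_pM2r // ler_pM2l; lra.
by move: key; rewrite /t /a; nra.
Qed.

Unset Implicit Arguments.

Theorem mainTheorem9 (R : realFieldType) (T E : finType) (ends : E -> T * T)
  (noloop : forall e, (ends e).1 != (ends e).2)
  (m : nat) (hm : (0 < m)%N) (eps : R) (heps : (0 < eps)%R)
  (f : T -> nat) (hfpos : forall v, (0 < f v)%N)
  (hf : forall v, ((2 * m%:R - 1) * (2 * m%:R / eps + 1) <= (f v)%:R :> R)%R)
  (htough : iso_tough ends (fun v => ((f v * (f v).+1)%N%:R : R)))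
  (hcomp : forall S : {set T},
     ((ncomp ends S)%:R <= #|S|%:R / (2 * m%:R + eps) + 1 :> R)%R) :
  exists F : {set E}, ff1_factor ends f F /\ tree_connected ends m F.
Proof.
case: (posnP #|T|) => [T0|T0].
  have noT (v : T) : False by have := fintype0 v T0.
  exists set0; split=> [v|]; first by case: (noT v).
  exists (fun _ => set0); split; [|split] => [i|i|i j _]; first exact: sub0set.
    apply/andP; split; first by apply/forallP=> v; case: (noT v).
    by apply/forall_inP=> e; rewrite in_set0.
  by rewrite -setI_eq0 set0I.
have [v0 _] := card_gt0P T0.
have [u _ umin] := @arg_minnP _ v0 predT f isT.
pose r := f u.
have rf v : (r <= f v)%N by apply: umin.
have m1 : 1 <= m%:R :> R by rewrite ler1n.
(* The summand [2m / eps] makes the bound strictly larger than [2m - 1], and [r] is an integer. *)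
have le_r : (2 * m <= r)%N.
  have : (2 * m%:R - 1) * 1 < r%:R :> R.
    apply: lt_le_trans (hf u); rewrite ltr_pM2l; last by lra.
    by rewrite ltrDr divr_gt0 //; lra.
  have -> : (2 * m%:R - 1) * 1 = (2 * m).-1%:R :> R.
    by rewrite mulr1 -subn1 natrB ?natrM // muln_gt0.
  by rewrite ltr_nat; lia.
pose g : rel T := fun x y => [exists e, joins ends e x y].
have gsym : symmetric g by move=> x y; apply: eq_existsb => e; rewrite /joins orbC.
have girr v : ~~ g v v.
  by apply/existsP=> -[e /orP[] /eqP ee]; have := noloop e; rewrite ee eqxx.
have f_gt1 v : (1 < f v)%N by have := rf v; lia.
have iso S : (\sum_(v in isolated_in g S) f v * (f v).+1 <= #|S|)%N.
  by have := htough S; rewrite -natr_sum ler_nat.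
have t2 : 2 < 2 * m%:R + eps by lra.
have t0 : 0 < 2 * m%:R + eps by lra.
have conn : (#|components g set0| <= 1)%N.
  by have := hcomp set0; rewrite cards0 mul0r add0r (ler_nat _ _ 1).
have tough (S : {set T}) : S != set0 -> (2 * #|components g S| < #|S| + 2)%N.
  rewrite -card_gt0 => S0; rewrite -(ltr_nat R) natrM natrD.
  apply: (@le_lt_trans _ _ (2 * (#|S|%:R / (2 * m%:R + eps) + 1))).
    by rewrite ler_pM2l ?ltr0n // hcomp.
  rewrite mulrDr mulr1 ltrD2r mulrCA gtr_pMr ?ltr0n // ltr_pdivrMr // mul1r.
  by [].
have [h [D [hs hg cD hd]]] := near_factor gsym girr f_gt1 iso conn tough.
have [F [Fdeg Fsimple]] := edge_set_of_rel noloop hs (fun x y hxy => existsP (hg x y hxy)).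
(* The vertex of [D] already has degree [f v + 1] in [F], so the matching must avoid it. *)
pose L := [set e | [&& e \notin F, (ends e).1 \notin D & (ends e).2 \notin D]].
have FL : [disjoint F & L].
  by rewrite -setI_eq0; apply/eqP/setP=> e; rewrite !inE; case: (e \in F).
have adm0 : admissible ends m F L set0.
  apply/andP; split.
    by apply/sparseP=> U U0; rewrite set0I cards0 add0n leq_pmulr // card_gt0.
  by rewrite set0D; apply/edge_matchingP; rewrite sub0set; split=> // e d v; rewrite in_set0.
(* Lexicographic maximality in one number: [#|X :&: F|] is less than [#|E|.+1]. *)
pose weight (X : {set E}) := (#|X| * #|E|.+1 + #|X :&: F|)%N.
have [X Xadm Xmax] := @arg_maxnP _ set0 (admissible ends m F L) weight adm0.
have XF (Y : {set E}) : (#|Y :&: F| <= #|E|)%N by apply: max_card.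
have Xmax1 Y : admissible ends m F L Y -> (#|Y| <= #|X|)%N.
  move/Xmax; rewrite /weight => le1; rewrite leqNgt; apply/negP=> lt.
  have : (#|X|.+1 * #|E|.+1 <= #|Y| * #|E|.+1)%N by rewrite leq_mul2r lt orbT.
  by move: le1 (XF X); rewrite mulSn; lia.
have Xmax2 Y : admissible ends m F L Y -> #|Y| = #|X| -> (#|Y :&: F| <= #|X :&: F|)%N.
  move=> aY eYX; have : (weight Y <= weight X)%N := Xmax Y aY.
  by rewrite /weight eYX leq_add2l.
have /andP[sX mX] := Xadm; have /edge_matchingP[XL Xm] := mX.
have tX : tight ends m X setT.
  have T0' : [set: T] != set0 by rewrite -card_gt0 cardsT.
  have := sparseP _ _ _ sX _ T0'; rewrite /tight T0' /= leq_eqVlt => /orP[//|].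
  rewrite insideT setIT cardsT => nt; exfalso.
  have [M [MX _ _] wL] := flexible_minimal noloop FL Xadm Xmax1.
  have sXM : sparse ends m (X :\: M) by apply: sparse_sub sX; apply: subsetDl.
  have wF e : e \in F -> e \notin X -> (ends e).2 \in cls ends m (X :\: M) (ends e).1.
    move=> eF eX; have := span_F Xadm Xmax1 Xmax2 eF eX; apply/subsetP.
    apply: cls_sub => //; apply/subsetP=> d /setIP[dX dF]; rewrite in_setD dX andbT.
    by apply/negP=> /(subsetP MX); rewrite in_setD dF.
  have wL' e : e \notin F -> (forall v, incident ends v e -> v \notin covered ends M :|: D) ->
      (ends e).2 \in cls ends m (X :\: M) (ends e).1.
    move=> eF he; have he' v : incident ends v e -> (v \notin covered ends M) && (v \notin D).
      by move/he; rewrite in_setU negb_or.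
    apply: wL => [|v /he'/andP[] //]; rewrite inE eF /=; apply/andP; split.
      by have /he'/andP[] : incident ends (ends e).1 e by rewrite /incident eqxx.
    by have /he'/andP[] : incident ends (ends e).2 e by rewrite /incident eqxx orbT.
  have Fr v : (r <= deg ends F v)%N by rewrite Fdeg hd; apply: leq_trans (rf v) (leq_addr _ _).
  have [S [c [q [z [s1 [s2 [k [N1 N2 N3 N4 [N5 N6]]]]]]]]] :=
    component_bound noloop sX MX wF wL' Fr Fsimple hm le_r nt cD.
  exact: gap_contradiction heps hm (hf u) N1 N2 N3 N4 N5 N6 (hcomp S).
exists (F :|: X); split; last first.
  exact: tree_connected_of_tight T0 sX tX (subsetUr _ _).
move=> v; have dU : deg ends (F :|: X) v = (deg ends F v + deg ends (X :\: F) v)%N.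
  rewrite /deg -(cardsID F); congr (_ + _)%N; apply: eq_card => e; rewrite !inE.
    by case: (e \in F); rewrite ?andbT ?andbF.
  by case: (e \in F); rewrite ?andbT ?andbF.
rewrite dU Fdeg hd -addnA leq_addr /= -[(f v).+1]addn1 leq_add2l.
have d1 : (deg ends (X :\: F) v <= 1)%N.
  apply/card_le1_eqP=> e d; rewrite !inE => /andP[eX ve] /andP[dX vd].
  by apply: Xm vd ve; rewrite in_setD.
case: (boolP (v \in D)) => // vD; rewrite -[leqRHS]addn0 leq_add2l leqn0 cards_eq0.
apply/eqP/setP=> e; rewrite in_set0 inE; apply/negP=> /andP[eX ve].
have := subsetP XL _ eX; rewrite inE => /and3P[_ h1 h2].
by case/orP: ve => /eqP ev; rewrite ev vD in h1 h2.
Qed.
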